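(* Let $n,m\ge1$. For $(\mathcal{R},i)\in\mathcal{R}_+^m(A_{n-1})\times\{1,\ldots,mn+1\}$, let $w\mathcal{A}_0$ be the $m$-minimal alcove of $\mathcal{R}$ and let $k_i$ be the $i$-th smallest element of the $m$-admissible set $\mathscr{K}_m(w)$. The map ${\sf Bj}_1$ sending $(\mathcal{R},i)$ to the region $\mathcal{R}'\in\mathcal{R}_+^m(C_n)$ whose $m$-minimal alcove corresponds to $\alpha(w_{[k_i]})$ is a bijection $\mathcal{R}_+^m(A_{n-1})\times\{1,\ldots,mn+1\}\to\mathcal{R}_+^m(C_n)$.
   Context: For a crystallographic root system $\Phi$ and $m\ge1$, the $m$-Shi arrangement consists of hyperplanes $\{x:\langle x,\alpha\rangle=k\}$, $\alpha\in\Phi^+$, $-m<k\le m$; $\mathcal{R}_+^m(\Phi)$ is the set of its regions contained in the dominant chamber $\{x:\langle x,\alpha\rangle\ge0\ \forall\alpha\in\Phi^+\}$. Each such region contains a unique alcove (region of the arrangement of all hyperplanes $\{\langle x,\alpha\rangle=k\}$, $k\in\mathbb{Z}$) closest to the origin, its $m$-minimal alcove; an alcove is $m$-minimal if it is the $m$-minimal alcove of some dominant region. For $N\ge1$, base-level notation w.r.t. $N$: $a=r^{\ell}$ means $a=r+N\ell$, $r\in\{1,\ldots,N\}$, $\ell\in\mathbb{Z}$. $\mathcal{M}(A_{N-1})$ is the set of bijections $w:\mathbb{Z}\to\mathbb{Z}$ with $w(x+N)=w(x)+N$, $\sum_{i=1}^N w(i)=\binom{N+1}{2}$ and $w(1)<\cdots<w(N)$;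 dominant alcoves of type $A_{N-1}$ are the $w\mathcal{A}_0$, $w\in\mathcal{M}(A_{N-1})$. The level vector $(\beta_1,\ldots,\beta_N)$ of $w$ has $\beta_i$ = level of the entry of $[w(1),\ldots,w(N)]$ with base $i$. Dominant alcoves of type $C_n$ are identified with the $\bar w\in\mathcal{M}(A_{2n-1})$ with balanced abacus (level vector of the form $(\beta_1,\ldots,\beta_n,-\beta_n,\ldots,-\beta_1)$). It is known that $w\mathcal{A}_0$ is $m$-minimal in type $A_{N-1}$ iff $\beta_{i+1}-\beta_i\le m$ ($1\le i\le N-1$) and $\beta_1-\beta_N-1\le m$, and that a balanced $\bar w$ is $m$-minimal in type $C_n$ iff it is $m$-minimal in type $A_{2n-1}$. The $k$-shift of $w\in\mathcal{M}(A_{n-1})$ is $w_{[k]}=(w(1)+k,\ldots,w(n)+k)$, written w.r.t. $n$ as $[r_1^{a_1},\ldots,r_n^{a_n}]$; its antisymmetric expansion $\alpha(w_{[k]})$ is the element of $\mathcal{M}(A_{2n-1})$ whose base window is the increasing arrangement of the integers $r_i+2na_i$ and $(2n+1-r_i)-2na_i$, $1\le i\le n$. For an $m$-minimal $w\mathcal{A}_0$ of type $A_{n-1}$, its $m$-admissible set $\mathscr{K}_m(w)$ is the set of $k\in\mathbb{Z}$ for which $\alpha(w_{[k]})$ is an $m$-minimal alcove of type $C_n$; this set has exactly $mn+1$ elements. *)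

(* Defs.v *)
From HB Require Import structures.
From mathcomp Require Import all_boot all_order all_algebra.
From mathcomp Require Import all_classical all_reals all_analysis.

Set Implicit Arguments.
Unset Strict Implicit.
Unset Printing Implicit Defensive.

Import Order.TTheory GRing.Theory Num.Theory.
Import numFieldNormedType.Exports.

Local Open Scope classical_set_scope.
Local Open Scope card_scope.
Local Open Scope ring_scope.

(* The data of a root system that the arrangements depend on: the Euclidean
   space spanned by the roots, as a subspace of R^d, and the positive roots. *)
Record posSystem (R : realType) (d : nat) := PosSystem {
  ambient : set 'rV[R]_d;
  posroot : set 'rV[R]_d
}.

Section Arrangements.
Variables (R : realType) (d : nat) (Phi : posSystem R d).
Implicit Types (x a : 'rV[R]_d) (A B C : set 'rV[R]_d) (k : int) (m : nat).

Definition dot x a : R := \sum_i x ord0 i * a ord0 i.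

Definition hyperplane a k : set 'rV[R]_d :=
  [set x | ambient Phi x /\ dot x a = k%:~R].

Definition shi_arrangement m : set (set 'rV[R]_d) :=
  [set H | exists a k, [/\ posroot Phi a, - m%:Z < k, k <= m%:Z
                         & H = hyperplane a k]].

Definition affine_arrangement : set (set 'rV[R]_d) :=
  [set H | exists a k, posroot Phi a /\ H = hyperplane a k].

Definition arr_complement (Arr : set (set 'rV[R]_d)) : set 'rV[R]_d :=
  [set x | ambient Phi x /\ forall H, Arr H -> ~ H x].

Definition is_region (Arr : set (set 'rV[R]_d)) C :=
  exists2 x, arr_complement Arr x
           & C = connected_component (arr_complement Arr) x.

Definition dominant_chamber : set 'rV[R]_d :=
  [set x | ambient Phi x /\ forall a, posroot Phi a -> 0 <= dot x a].

Definition dominant_region m : set (set 'rV[R]_d) :=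
  [set C | is_region (shi_arrangement m) C /\ C `<=` dominant_chamber].

Definition is_alcove A := is_region affine_arrangement A.

Definition fundamental_alcove : set 'rV[R]_d :=
  [set x | ambient Phi x /\ forall a, posroot Phi a -> 0 < dot x a < 1].

(* The hyperplanes strictly separating A from the origin, each given by its
   unique defining pair (a, k) with a a positive root. *)
Definition separating A : set ('rV[R]_d * int) :=
  [set h | posroot Phi h.1 /\
    ((0 < h.2 /\ forall x, A x -> h.2%:~R < dot x h.1) \/
     (h.2 < 0 /\ forall x, A x -> dot x h.1 < h.2%:~R))].

(* Distance from the origin is the number of separating hyperplanes. *)
Definition is_min_alcove C A :=
  [/\ is_alcove A, A `<=` C
    & forall B, is_alcove B -> B `<=` C -> separating A #<= separating B].

Definition m_minimal m A := exists2 C, dominant_region m C & is_min_alcove C A.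

End Arrangements.

Definition typeA (R : realType) (N : nat) : posSystem R N :=
  {| ambient := [set x | \sum_i x ord0 i = 0];
     posroot := [set a | exists i j : 'I_N, (i < j)%N /\
                  a = delta_mx ord0 i - delta_mx ord0 j] |}.

Definition typeC (R : realType) (n : nat) : posSystem R n :=
  {| ambient := setT;
     posroot := [set a |
       (exists i j : 'I_n, (i < j)%N /\
          (a = delta_mx ord0 i - delta_mx ord0 j \/
           a = delta_mx ord0 i + delta_mx ord0 j)) \/
       (exists i : 'I_n, a = delta_mx ord0 i *+ 2)] |}.

(* a = base N a + N * level N a with base N a in {1, ..., N}, for N >= 1. *)
Definition base (N : nat) (a : int) : int := modz (a - 1) N%:Z + 1.
Definition level (N : nat) (a : int) : int := divz (a - 1) N%:Z.

(* The elements of M(A_{N-1}). *)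
Definition min_affine_perm (N : nat) (w : int -> int) : Prop :=
  [/\ bijective w,
      forall x, w (x + N%:Z) = w x + N%:Z,
      \sum_(1 <= i < N.+1) w i%:Z = ('C(N.+1, 2))%:Z
    & forall i j : nat, (0 < i)%N -> (i < j)%N -> (j <= N)%N ->
        w i%:Z < w j%:Z].

(* x in R^N extended to a function on Z by x_{a + N} = x_a - 1; the argument of
   insub is base N a - 1, the coordinates of x being numbered from 0. *)
Definition extend (R : realType) (N : nat) (x : 'rV[R]_N) (a : int) : R :=
  oapp (fun j : 'I_N => x ord0 j) 0 (insub `|modz (a - 1) N%:Z|%N)
    - (level N a)%:~R.

(* Affine permutations act on R^N by x |-> (x_{w(1)}, ..., x_{w(N)}).  For this
   action the image of the fundamental alcove lies in the dominant chamber
   x_1 >= ... >= x_N iff w(1) < ... < w(N), and the wall between the entries of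
   bases i and i + 1 has the equation x_p - x_q = beta_{i+1} - beta_i, where
   p, q are their positions in the base window and beta is the level vector. *)
Definition affine_act (R : realType) (N : nat) (w : int -> int)
    (x : 'rV[R]_N) : 'rV[R]_N :=
  \row_(i < N) extend x (w (i.+1)%:Z).

Definition alcoveA (R : realType) (N : nat) (w : int -> int) : set 'rV[R]_N :=
  [set affine_act w x | x in fundamental_alcove (typeA R N)].

(* (x_1, ..., x_n) |-> (x_1, ..., x_n, -x_n, ..., -x_1). *)
Definition antisym (R : realType) (n : nat) (x : 'rV[R]_n) : 'rV[R]_(n + n) :=
  row_mx x (\row_(i < n) - x ord0 (rev_ord i)).

(* The roots of A_{2n-1} restrict along antisym to those of C_n.  The dominant
   alcoves of type C_n are the sets below with w in M(A_{2n-1}) balanced. *)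
Definition alcoveC (R : realType) (n : nat) (w : int -> int) : set 'rV[R]_n :=
  [set x | @alcoveA R (n + n) w (antisym x)].

(* The affine permutation with base window s (of size N). *)
Definition of_window (N : nat) (s : seq int) (x : int) : int :=
  nth 0 s `|modz (x - 1) N%:Z|%N + N%:Z * level N x.

Definition shift_window (n : nat) (w : int -> int) (k : int) : seq int :=
  [seq w i%:Z + k | i <- iota 1 n].

(* The affine permutation alpha(w_[k]) in M(A_{2n-1}). *)
Definition expansion (n : nat) (w : int -> int) (k : int) : int -> int :=
  let u := shift_window n w k in
  of_window (n + n)
    (sort <=%R
      ([seq base n a + (2 * n)%N%:Z * level n a | a <- u] ++
       [seq ((2 * n).+1%:Z - base n a) - (2 * n)%N%:Z * level n a | a <- u])).

Definition admissible (R : realType) (n m : nat) (w : int -> int) : set int :=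
  [set k | m_minimal (typeC R n) m (alcoveC (R := R) (n := n) (expansion n w k))].

(* k is the element of K with exactly i smaller ones: (i+1)-st smallest. *)
Definition is_nth_smallest (K : set int) (i : nat) (k : int) : Prop :=
  K k /\ [set k' | K k' /\ k' < k] #= `I_i.

(* The graph of Bj_1; the index i, counted from 0, stands for the paper's i+1. *)
Definition Bj1_graph (R : realType) (n m : nat)
    (C : set 'rV[R]_n) (i : nat) (C' : set 'rV[R]_n) : Prop :=
  exists w k,
    [/\ min_affine_perm n w,
        is_min_alcove (typeA R n) C (alcoveA (R := R) (N := n) w),
        is_nth_smallest (admissible R n m w) i k
      & is_min_alcove (typeC R n) C'
          (alcoveC (R := R) (n := n) (expansion n w k))].

(* Main.v *)
Require Import Defs.
From mathcomp Require Import all_boot all_order all_algebra.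
From mathcomp Require Import all_classical all_reals all_analysis.
From mathcomp Require Import finmap zify ring lra.

Set Implicit Arguments.
Unset Strict Implicit.
Unset Printing Implicit Defensive.

Import Order.TTheory GRing.Theory Num.Theory.
Import numFieldNormedType.Exports.

Local Open Scope classical_set_scope.
Local Open Scope card_scope.
Local Open Scope ring_scope.

(** A dominant alcove is encoded by its base window u, an increasing system of
    residues modulo N; on it the root e_i - e_j takes values between k and
    k + 1, where k is the integer part of (u_j - u_i) / N.  Call u an m-core if
    for every entry v some entry v' = v - 1 mod N satisfies v' >= v - 1 - m N.

    - If u is not an m-core, then reflecting the alcove in one of its walls (a
      wall with level > m) stays in the same m-Shi region and decreases the sum
      of the squares of the entries, so every region contains an m-core.
    - If u is an m-core, a difference u_j - u_i > m N splits at some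
      intermediate entry into two smaller ones, so its levels are bounded below
      by those of any alcove of its region.  Hence the m-core is the minimal
      alcove of the region, and it is unique.
    - Type C_n is obtained from A_{2n-1} by restricting to antisymmetric points:
      the same arguments apply to balanced windows.
    - A pair (w, k) is the same as an arbitrary level vector in Z^n, which is the
      same as a balanced level vector in Z^{2n}; the m-core condition on the
      latter implies the one on w.  For an m-core w, the shift k is admissible
      iff a predicate A, closed under subtracting m n + 1, holds at -k and fails
      at -k + m n + 1; this happens for exactly one k in each residue class
      modulo m n + 1. *)

(** * Windows and Shi regions *)

Definition transversal (N : nat) (u : 'I_N -> int) : Prop :=
  forall i j (t : int), u i = u j + t * N%:Z -> i = j.

Definition increasing (N : nat) (u : 'I_N -> int) : Prop :=
  forall i j : 'I_N, (i < j)%N -> u i < u j.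

Definition window (N : nat) (u : 'I_N -> int) : Prop :=
  [/\ increasing u, transversal u & \sum_i u i = ('C(N.+1, 2))%:Z].

(* The beta-set of u is closed under subtracting m N + 1, i.e. u describes an
   (N, m N + 1)-core. *)
Definition mcore (N m : nat) (u : 'I_N -> int) : Prop :=
  forall i, exists j (t : int), t <= m%:Z /\ u j = u i - 1 - t * N%:Z.

(** [shi_le] in both directions means lying in the same m-Shi region. Levels t <= 0 are harmless:
    for increasing windows both inequalities then hold. *)
Definition shi_le (N m : nat) (u v : 'I_N -> int) : Prop :=
  forall i j : 'I_N, (i < j)%N -> forall t : int, t <= m%:Z ->
    t * N%:Z < u j - u i -> t * N%:Z < v j - v i.

Lemma increasing_lt N (u : 'I_N -> int) (i j : 'I_N) :
  increasing u -> u i < u j -> (i < j)%N.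
Proof.
move=> iu h; rewrite ltnNge; apply/negP => ji; move: h.
by case: (ltngtP j i) ji => // [/iu ?|/val_inj->] _; lia.
Qed.

Lemma ord_lt_neq N (i j : 'I_N) : (i < j)%N -> i != j.
Proof. by move=> ij; apply: contraTneq ij => ->; rewrite ltnn. Qed.

(** Pigeonhole: the map from indices to residues is injective between sets of size N, hence onto. *)
Lemma transversal_cover N (u : 'I_N -> int) z :
  (0 < N)%N -> transversal u -> exists i t, u i = z + t * N%:Z.
Proof.
case: N u => // N u _ tu.
pose f i : 'I_N.+1 := inord `|modz (u i) N.+1|%N.
have fE x : (nat_of_ord (inord `|modz x N.+1|%N : 'I_N.+1))%:Z = modz x N.+1.
  have h1 := modz_ge0 x (isT : N.+1%:Z != 0).
  have h2 := ltz_pmod x (isT : 0 < N.+1%:Z).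
  by rewrite inordK; lia.
have finj : injective f.
  move=> i j eij; have := fE (u i); rewrite -/(f i) eij fE => e.
  apply: (tu _ _ (divz (u i) N.+1 - divz (u j) N.+1)).
  by have := divz_eq (u i) N.+1; have := divz_eq (u j) N.+1; rewrite mulrBl; lia.
have [g fK gK] := injF_bij finj.
pose i := g (inord `|modz z N.+1|%N).
exists i, (divz (u i) N.+1 - divz z N.+1).
have e : modz (u i) N.+1 = modz z N.+1 by rewrite -fE -/(f i) gK fE.
by have := divz_eq (u i) N.+1; have := divz_eq z N.+1; rewrite mulrBl; lia.
Qed.

Lemma transversal_neq N (u : 'I_N -> int) i j t :
  transversal u -> i != j -> u j - u i != t * N%:Z.
Proof.
move=> tu nij; apply/eqP => e; move/negP: nij; apply; apply/eqP.
by apply: (tu _ _ (- t)); rewrite mulNr -e; ring.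
Qed.

(* Going down from u j one residue at a time, the beads visited stay above
   u j until a first bead b drops below; by the core condition it drops by at
   most m levels, so a large difference (i, j) splits at b. *)
Lemma mcore_split N m (u : 'I_N -> int) i j t :
  window u -> mcore m u -> m%:Z < t -> t * N%:Z < u j - u i ->
  exists (b : 'I_N) s, [/\ (i < b < j)%N, s <= m%:Z, s * N%:Z < u j - u b
                & (t - s) * N%:Z < u b - u i].
Proof.
move=> [iu tu _] cu mt htij.
have N0 : (0 < N)%N by apply: leq_ltn_trans (ltn_ord i).
pose P s := [exists b, (u b < u j - s%:Z) && (N%:Z %| u j - s%:Z - u b)%Z].
pose d := u j - u i.
pose k := divz d N; pose r := modz d N.
have dE : d = k * N + r by exact: divz_eq.
have r0 : 0 <= r by apply: modz_ge0; lia.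
have rN : r < N by apply: ltz_pmod; lia.
have mk : m%:Z < k.
  apply: (lt_le_trans mt); rewrite /k lez_divRL; lia.
(* The bead i itself witnesses [P r], so the least such s is at most r. *)
have exP : exists s, P s.
  exists `|r|%N; apply/existsP; exists i; rewrite gez0_abs //; apply/andP; split.
    by nia.
  by apply/dvdzP; exists k; nia.
case: (ex_minnP exP) => s /existsP[b /andP[bs /dvdzP[q bq]]] smin.
have sr : s%:Z <= r.
  suff : (s <= `|r|)%N by lia.
  apply: smin; apply/existsP; exists i; rewrite gez0_abs //; apply/andP; split.
    by nia.
  by apply/dvdzP; exists k; nia.
have q0 : 0 < q by nia.
have s0 : (0 < s)%N.
  rewrite lt0n; apply/eqP => s0; move: bs bq; rewrite s0 subr0 => bs bq.
  have e : j = b by apply: (tu _ _ q); rewrite -bq; ring.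
  by rewrite e ltxx in bs.
(* The bead c, one residue before b, has not dropped below u j - (s - 1) by minimality of s; the
   core condition at c then bounds the drop q at b by m. *)
have [c [t1 ct]] := transversal_cover (u j - (s%:Z - 1)) N0 tu.
have t10 : 0 <= t1.
  rewrite leNgt; apply/negP => t1n.
  suff : (s <= s.-1)%N by lia.
  apply: smin; apply/existsP; exists c; apply/andP; split; first by nia.
  apply/dvdzP; exists (- t1); rewrite ct; lia.
have [b' [t2 [t2m b't]]] := cu c.
have bb' : b' = b.
  apply: (tu _ _ (t1 - t2 + q)); rewrite b't ct.
  have -> : u b = u j - s%:Z - q * N by rewrite -bq; ring.
  ring.
rewrite {b'}bb' in b't.
have qt : q = t2 - t1.
  have : (q - (t2 - t1)) * N = 0.
    by rewrite mulrBl -bq b't ct; ring.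
  by move/eqP; rewrite mulf_eq0 => /orP[]; lia.
exists b, q.
have ubi : u b - u i = (k - q) * N + (r - s%:Z).
  rewrite mulrBl; have := dE; rewrite /d; lia.
have bi : (i < b)%N by apply: (increasing_lt iu); nia.
have rs : r != s%:Z.
  apply/eqP => rs; have := transversal_neq (k - q) tu (_ : i != b).
  rewrite ubi rs subrr addr0 eqxx => /(_ _)/negP; apply => //.
  by apply: contraTneq bi => ->; rewrite ltnn.
have kN : t * N <= k * N.
  by rewrite ler_wpM2r // /k lez_divRL; lia.
split; [|lia|by lia|].
  by rewrite bi /=; apply: (increasing_lt iu); nia.
by rewrite ubi !mulrBl; lia.
Qed.

(** Strong induction on j: a level above m splits at b into a level at most m for (b, j), covered by
    [shi_le], and a level for (i, b) with b < j. *)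
Lemma mcore_shi_le N m (u v : 'I_N -> int) :
  window u -> window v -> mcore m u -> shi_le m u v ->
  forall (i j : 'I_N), (i < j)%N -> forall t : int,
    t * N%:Z < u j - u i -> t * N%:Z < v j - v i.
Proof.
move=> wu wv cu uv i j; have [k] := ubnP (nat_of_ord j).
elim: k j => // k IH j jk ij t ht.
have [tm|mt] := lerP t m%:Z; first exact: uv ht.
have [b [s [/andP[ib bj] sm hs hts]]] := mcore_split wu cu mt ht.
have h1 := uv _ _ bj _ sm hs.
have h2 := IH b (leq_trans bj jk) ib _ hts.
by move: h1 h2; rewrite mulrBl; lia.
Qed.

(* The map u i + t N |-> v i + t N is an increasing bijection of the integers,
   hence a translation. *)
Lemma window_eq N (u v : 'I_N -> int) :
  window u -> window v ->
  (forall i j : 'I_N, (i < j)%N ->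
     forall t : int, t * N%:Z < u j - u i -> t * N%:Z < v j - v i) ->
  (forall i j : 'I_N, (i < j)%N ->
     forall t : int, t * N%:Z < v j - v i -> t * N%:Z < u j - u i) ->
  u =1 v.
Proof.
move=> [iu tu su] [iv tv sv] uv vu.
case: (posnP N) => [N0|N0]; first by move=> i; have := ltn_ord i; rewrite {2}N0.
have uvE i j t : t * N%:Z < u j - u i -> t * N%:Z < v j - v i.
  case: (ltngtP i j) => [ij|ji|/val_inj->]; [exact: uv| |by rewrite !subrr].
  move=> h; have nij : i != j by rewrite eq_sym; exact: ord_lt_neq.
  have := transversal_neq t tv nij.
  case: (ltrgtP (t * N) (v j - v i)) => // h' _.
  by have := vu _ _ ji (- t); rewrite mulNr => /(_ _); lia.
have vuE i j t : t * N%:Z < v j - v i -> t * N%:Z < u j - u i.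
  case: (ltngtP i j) => [ij|ji|/val_inj->]; [exact: vu| |by rewrite !subrr].
  move=> h; have nij : i != j by rewrite eq_sym; exact: ord_lt_neq.
  have := transversal_neq t tu nij.
  case: (ltrgtP (t * N) (u j - u i)) => // h' _.
  by have := uv _ _ ji (- t); rewrite mulNr => /(_ _); lia.
(* Successors go to successors: both windows order the translates of their entries in the same way,
   so nothing fits between v i and its image successor. *)
have next i j (t : int) : u j = u i + 1 + t * N -> v j = v i + 1 + t * N.
  move=> e; have [l [s vl]] := transversal_cover (v i + 1) N0 tv.
  have h1 : u j - u i <= u l - u i - s * N + t * N.
    have : s * N < u l - u i by apply: vuE; lia.
    by rewrite e; lia.
  have h2 : v j - v i <= v l - v i - s * N + t * N.
    have [lj|jl] := eqVneq l j.
      subst l; have : s = t; last by move=> ->; lia.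
      by apply/eqP; rewrite eq_le; apply/andP; split;
         [have := vuE i j s | have := uvE i j t]; nia.
    have := uvE j l (s - t); rewrite mulrBl => /(_ _).
    have := transversal_neq (s - t) tu (_ : j != l).
    by rewrite mulrBl eq_sym => /(_ jl); lia.
  have : t * N < v j - v i by apply: uvE; lia.
  by lia.
have d i j (t : int) (k : nat) : u j = u i + k%:Z + t * N -> v j - u j = v i - u i.
  elim: k j t => [|k IH] j t e.
    by have <- : j = i by apply: (tu _ _ t); lia.
  have [l [s ul]] := transversal_cover (u j - 1) N0 tu.
  have := next l j (- s); rewrite mulNr => /(_ _).
  have := IH l (t + s); rewrite mulrDl => /(_ _); lia.
have dc i j : v j - u j = v i - u i.
  apply: (d i j (divz (u j - u i) N) `|modz (u j - u i) N|%N).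
  rewrite gez0_abs ?modz_ge0; [|lia..].
  by have := divz_eq (u j - u i) N; lia.
move=> i; apply/eqP; rewrite eq_sym -subr_eq0.
have : \sum_j (v j - u j) = 0 by rewrite sumrB su sv subrr.
rewrite (eq_bigr (fun=> v i - u i)) => [|j _]; last exact: dc.
by rewrite sumr_const card_ord => /eqP; rewrite mulrn_eq0 eqn0Ngt N0.
Qed.

(** * Reflections *)

(** Applied when [u q = u p + 1 + k * N]: the two entries then exchange residues, which reflects the
    alcove in the wall between these consecutive residues. *)
Definition reflect_window (N : nat) (u : 'I_N -> int) (p q : 'I_N) (i : 'I_N) :=
  if i == p then u p + 1 else if i == q then u q - 1 else u i.

Lemma mcoreVreflect N m (u : 'I_N -> int) : window u ->
  mcore m u \/ exists p q (k : int), m%:Z < k /\ u q = u p + 1 + k * N%:Z.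
Proof.
move=> [iu tu su].
have [/forallP c|/forallPn[q cq]] := boolP [forall i, [exists j,
    (u i - 1 - m%:Z * N%:Z <= u j) && (N%:Z %| u i - 1 - u j)%Z]].
  left=> i; have /existsP[j /andP[h /dvdzP[t e]]] := c i.
  exists j, t; split; last by rewrite -e; ring.
  rewrite leNgt; apply/negP => mt.
  have N0 : (0 < N)%N by apply: leq_ltn_trans (ltn_ord i).
  nia.
right; have N0 : (0 < N)%N by apply: leq_ltn_trans (ltn_ord q).
have [p [t e]] := transversal_cover (u q - 1) N0 tu.
exists p, q, (- t); split; last by rewrite e; ring.
rewrite ltNge; apply/negP => tm; move/negP: cq; apply.
apply/existsP; exists p; apply/andP; split; first by nia.
by apply/dvdzP; exists (- t); rewrite e; ring.
Qed.

Section Reflect.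
Variables (N m : nat) (u : 'I_N -> int) (p q : 'I_N) (k : int).
Hypothesis wu : window u.
Hypothesis mk : m%:Z < k.
Hypothesis uq : u q = u p + 1 + k * N%:Z.
Local Notation u' := (reflect_window u p q).

Let N0 : (0 < N)%N.
Proof. by apply: leq_ltn_trans (ltn_ord p). Qed.

Lemma reflect_lt : u p < u q. Proof. by rewrite uq; nia. Qed.

Let pq : (p < q)%N.
Proof. by case: wu => iu _ _; apply: increasing_lt reflect_lt. Qed.

Let N2 : (1 < N)%N.
Proof. by apply: leq_ltn_trans (ltn_ord q); apply: leq_trans pq. Qed.

(** A difference that changes by one cannot cross t N, since two entries of [u] would share a
    residue. For the pair (p, q) it goes from k N + 1 to k N - 1, and both exceed t N because t <= m
    < k. *)
Lemma reflect_shi (i j : 'I_N) (t : int) : (i < j)%N -> t <= m%:Z ->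
  (t * N%:Z < u' j - u' i) = (t * N%:Z < u j - u i).
Proof.
case: wu => iu tu _ ij tm; rewrite /reflect_window.
have nij : i != j := ord_lt_neq ij.
have := transversal_neq t tu nij.
have [ip|ip] := eqVneq i p.
  subst i; rewrite [j == p]eq_sym (negbTE nij); have [jq|jq] := eqVneq j q.
    by subst j; move=> _; rewrite uq; apply/idP/idP => _; nia.
  move=> _; have : u j != u q + (t - k) * N by apply/eqP => /tu; apply/eqP.
  by rewrite uq mulrBl => /eqP h; apply/idP/idP; lia.
have [iq|iq] := eqVneq i q.
  subst i; have -> : (j == p) = false by apply: contraTF ij => /eqP ->; lia.
  by rewrite [j == q]eq_sym (negbTE nij) => h; apply/idP/idP; lia.
have [jp|jp] := eqVneq j p.
  by subst j => h; apply/idP/idP; lia.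
have [jq|//] := eqVneq j q.
subst j => _; have : u i != u p + (k - t) * N by apply/eqP => /tu; apply/eqP.
by rewrite uq mulrBl => /eqP h; apply/idP/idP; lia.
Qed.

(** Used with the identity for the normalisation of windows and with squares for the descent. *)
Lemma reflect_sum (f : int -> int) :
  \sum_i f (u' i) = \sum_i f (u i) + (f (u p + 1) - f (u p))
                    + (f (u q - 1) - f (u q)).
Proof.
have qp : q != p by rewrite eq_sym; exact: ord_lt_neq.
rewrite (bigD1 p) //= (bigD1 q) //= [in RHS](bigD1 p) //= [in RHS](bigD1 q) //=.
rewrite /reflect_window !eqxx (negbTE qp).
rewrite (eq_bigr (fun i => f (u i))) => [|i /andP[/negbTE-> /negbTE->]//].
ring.
Qed.

Lemma window_reflect : window u'.
Proof.
case: (wu) => iu tu su; split.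
(* Being increasing is the Shi comparison at level 0. *)
- move=> i j ij; have := @reflect_shi i j 0 ij isT.
  by rewrite mul0r !subr_gt0 iu.
- have n1 (s : int) : s * N != 1 by have [s0|s0] := lerP s 0; have := N2; nia.
  move=> i j t; rewrite /reflect_window.
  have [->|ip] := eqVneq i p; have [->|jp] := eqVneq j p => //.
  + have [->|jq] := eqVneq j q => e.
      by case/eqP: (n1 (k + t)); rewrite uq in e; lia.
    have jq' : q = j by apply: (tu _ _ (k + t)); rewrite uq mulrDl; lia.
    by rewrite -jq' eqxx in jq.
  + have [->|iq] := eqVneq i q => e.
      by case/eqP: (n1 (k - t)); rewrite mulrBl; lia.
    have jq' : i = q by apply: (tu _ _ (t - k)); rewrite uq mulrBl; lia.
    by rewrite jq' eqxx in iq.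
  + have [->|iq] := eqVneq i q; have [->|jq] := eqVneq j q => // e.
    * have jq' : p = j by apply: (tu _ _ (t - k)); rewrite mulrBl; lia.
      by rewrite -jq' eqxx in jp.
    * have jq' : i = p by apply: (tu _ _ (t + k)); rewrite mulrDl; lia.
      by rewrite jq' eqxx in ip.
    * exact: tu e.
- by rewrite (reflect_sum id) su; lia.
Qed.

Lemma reflect_shi_le : shi_le m u u' /\ shi_le m u' u.
Proof. by split=> i j ij t tm; rewrite reflect_shi. Qed.

Lemma reflect_sqr : \sum_i u' i ^+ 2 < \sum_i u i ^+ 2.
Proof.
rewrite (reflect_sum (fun x => x ^+ 2)) uq.
set S := \sum_i _; have : 0 < k * N by nia.
rewrite (_ : _ + _ + _ = S - 2 * (k * N)); last by ring.
by lia.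
Qed.

End Reflect.

Lemma shi_le_trans N m (u v w : 'I_N -> int) :
  shi_le m u v -> shi_le m v w -> shi_le m u w.
Proof. by move=> uv vw i j ij t tm /(uv _ _ ij _ tm)/(vw _ _ ij _ tm). Qed.

(** The balanced abacus condition read on the window: the map z -> N + 1 - z preserves the entries
    and negates their levels. *)
Definition balanced (N : nat) (u : 'I_N -> int) : Prop :=
  forall i, u (rev_ord i) = N.+1%:Z - u i.

Lemma exists_smaller_window N m (u : 'I_N -> int) : window u -> ~ mcore m u ->
  exists v, [/\ window v, shi_le m u v /\ shi_le m v u
              & \sum_i v i ^+ 2 < \sum_i u i ^+ 2].
Proof.
move=> wu; case: (mcoreVreflect m wu) => // -[p [q [k [mk uq]]]] _.
exists (reflect_window u p q); split.
- exact: (window_reflect wu mk uq).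
- exact: (reflect_shi_le wu mk uq).
- exact: (reflect_sqr wu mk uq).
Qed.

(* The walls of a balanced window come in pairs exchanged by reversal; either
   the wall is fixed, or the two reflections commute. *)
Lemma exists_smaller_balanced n m (u : 'I_(n + n) -> int) :
  window u -> balanced u -> ~ mcore m u ->
  exists v, [/\ window v, balanced v, shi_le m u v /\ shi_le m v u
              & \sum_i v i ^+ 2 < \sum_i u i ^+ 2].
Proof.
move=> wu bu; case: (mcoreVreflect m wu) => // -[p [q [k [mk uq]]]] _.
have rev_neq (i : 'I_(n + n)) : (rev_ord i == i) = false.
  by apply/eqP => /(congr1 val) /=; have := ltn_ord i; lia.
(* Reversal sends the wall (p, q) to the wall (p', q') with the same k. *)
have uq' : u (rev_ord p) = u (rev_ord q) + 1 + k * (n + n)%:Z.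
  by rewrite !bu; lia.
set p' := rev_ord q in uq'; set q' := rev_ord p in uq'.
have wv := window_reflect wu mk uq; have rv := reflect_shi_le wu mk uq.
have sv := reflect_sqr wu mk uq.
have qp : (q == p) = false.
  by apply: contraTF (reflect_lt mk uq) => /eqP ->; rewrite ltxx.
set v := reflect_window u p q in wv rv sv.
have [e|qq'] := eqVneq q' q.
  exists v; split=> // i; rewrite /v /reflect_window.
  have pe : rev_ord q = p by rewrite -e rev_ordK.
  have [->|ip] := eqVneq i p; first by rewrite -/q' e qp eqxx -e bu; lia.
  rewrite (can2_eq (@rev_ordK _) (@rev_ordK _)) -/q' e.
  have [_|iq] := eqVneq i q; first by rewrite -[in RHS]e bu; lia.
  by rewrite (can2_eq (@rev_ordK _) (@rev_ordK _)) pe (negbTE ip) bu.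
have q'p : (q' == p) = false by exact: rev_neq.
have p'q : (p' == q) = false by exact: rev_neq.
have p'p : (p' == p) = false.
  by apply: contraNF qq' => /eqP e; rewrite /q' -e rev_ordK.
have vE : v q' = v p' + 1 + k * (n + n)%:Z.
  by rewrite /v /reflect_window q'p p'q p'p (negbTE qq').
have ww := window_reflect wv mk vE; have [rw1 rw2] := reflect_shi_le wv mk vE.
have sw := reflect_sqr wv mk vE.
exists (reflect_window v p' q'); split=> //; last exact: lt_trans sw sv.
  move=> i; rewrite /reflect_window.
  rewrite !(can2_eq (@rev_ordK _) (@rev_ordK _)) !rev_ordK.
  have p'q' : (p' == q') = false.
    by apply/eqP => /(can_inj (@rev_ordK _))/eqP; rewrite qp.
  have [->|iq] := eqVneq i q.
    rewrite eq_sym p'q eq_sym (negbTE qq') /v /reflect_window !eqxx qp p'q p'p.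
    by rewrite bu; lia.
  have [->|ip] := eqVneq i p.
    rewrite eq_sym p'p eq_sym q'p /v /reflect_window !eqxx q'p (negbTE qq').
    by rewrite bu; lia.
  have [ip'|ip'] := eqVneq i p'.
    rewrite ip' /p' rev_ordK -/p' /v /reflect_window eqxx qp p'q p'p bu; lia.
  have [iq'|iq'] := eqVneq i q'.
    rewrite iq' /q' rev_ordK -/q' /v /reflect_window eqxx q'p (negbTE qq') bu; lia.
  rewrite /v /reflect_window !(can2_eq (@rev_ordK _) (@rev_ordK _)) -/p' -/q'.
  by rewrite (negbTE ip) (negbTE iq) (negbTE ip') (negbTE iq') bu.
by case: rv => rv1 rv2; split; [exact: shi_le_trans rw1|exact: shi_le_trans rw2 _].
Qed.

(** * Regions of an arrangement *)

Section Dot.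
Variables (R : realType) (d : nat).
Implicit Types x y a : 'rV[R]_d.

Lemma dot_is_linear c x y a : dot (c *: x + y) a = c * dot x a + dot y a.
Proof.
by rewrite /dot mulr_sumr -big_split /=; apply: eq_bigr => i _; rewrite !mxE; ring.
Qed.

Lemma dotDr x a b : dot x (a + b) = dot x a + dot x b.
Proof. by rewrite /dot -big_split /=; apply: eq_bigr => i _; rewrite !mxE; ring. Qed.

Lemma dotNr x a : dot x (- a) = - dot x a.
Proof. by rewrite /dot -sumrN; apply: eq_bigr => i _; rewrite !mxE; ring. Qed.

Lemma dot_delta x i : dot x (delta_mx ord0 i) = x ord0 i.
Proof.
rewrite /dot (bigD1 i) //= big1 => [|j /negbTE ji]; rewrite !mxE ?eqxx ?ji /=; ring.
Qed.

Lemma dot_continuous a : continuous (fun x => dot x a).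
Proof.
apply: continuous_big => [|i _ x]; first exact: add_continuous.
have h := @coord_continuous R 1 d ord0 i x.
exact: (cvgMr_tmp h).
Qed.

End Dot.

Section Regions.
Variables (R : realType) (d : nat) (Phi : posSystem R d).
Variables (Arr : set (set 'rV[R]_d)) (Q : 'rV[R]_d -> int -> Prop).
Hypothesis ArrP : forall H, Arr H <-> exists a k, Q a k /\ H = hyperplane Phi a k.
Hypothesis ambientP : forall x y c, ambient Phi x -> ambient Phi y ->
  ambient Phi (c *: (y - x) + x).

Lemma arr_complementP x : arr_complement Phi Arr x <->
  ambient Phi x /\ forall a k, Q a k -> dot x a <> k%:~R.
Proof.
split=> -[ax h]; split=> //.
  move=> a k qak e; apply: (h (hyperplane Phi a k)) => //.
  by apply/ArrP; exists a, k.
by move=> H /ArrP[a [k [qak ->]]] [_]; exact: h.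
Qed.

(** A linear form that avoids k on a connected set stays on one side of k. Conversely, if x and y
    are on the same sides, the segment joining them avoids every hyperplane. *)
Lemma componentP x y : arr_complement Phi Arr x ->
  connected_component (arr_complement Phi Arr) x y <->
  arr_complement Phi Arr y /\
  forall a k, Q a k -> (k%:~R < dot x a) = (k%:~R < dot y a).
Proof.
move=> cx; split=> [cxy|[cy side]].
  split; first exact: connected_component_sub cxy.
  move=> a k qak.
  have := @component_connected _ (arr_complement Phi Arr) x.
  set C := connected_component _ _ => cC.
  have Cx : C x by exact: connected_component_refl.
  have : is_interval ((fun z => dot z a) @` C).
    apply/connected_intervalP/connected_continuous_connected => //.
    by apply: continuous_subspaceT; exact: dot_continuous.
  move=> itv.
  have Ck z : C z -> dot z a <> k%:~R.
    by move=> /connected_component_sub/arr_complementP[_]; apply.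
  have nb z1 z2 : C z1 -> C z2 -> k%:~R < dot z1 a -> k%:~R < dot z2 a.
    move=> C1 C2 h; rewrite ltNge; apply/negP => h2.
    have [|z Cz e] := itv _ _ (imageP _ C2) (imageP _ C1) k%:~R.
      by rewrite h2 ltW.
    exact: Ck Cz e.
  by apply/idP/idP; apply: nb.
pose f (t : R) : 'rV[R]_d := t *: (y - x) + x.
have cf : continuous f.
  move=> t; apply: cvgD; last exact: cvg_cst.
  by apply: cvgZr_tmp.
exists (f @` `[0, 1]); last first.
  by exists 1; [rewrite /= in_itv /= lexx ler01|rewrite /f scale1r subrK].
split.
- by exists 0; [rewrite /= in_itv /= lexx ler01|rewrite /f scale0r add0r].
- move=> _ [t /= t01 <-]; move: t01; rewrite in_itv /= => /andP[t0 t1].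
  have [/arr_complementP[ax hx] /arr_complementP[ay hy]] := (cx, cy).
  apply/arr_complementP; split; first exact: ambientP.
  move=> a k qak; rewrite /f dot_is_linear.
  have -> : dot (y - x) a = dot y a - dot x a.
    by rewrite -[y - x](addrC) -scaleN1r dot_is_linear mulN1r addrC.
  have := side a k qak; have := hx a k qak; have := hy a k qak.
  move: (dot x a) (dot y a) (k%:~R) => p q r qr pr.
  have conv (p' q' : R) : 0 < p' -> 0 < q' -> 0 < t * (q' - p') + p'.
    by move=> p0 q0; have [h|h] := lerP p' q'; nra.
  have [rp|rp] := ltP r p => e.
    have rq : r < q by rewrite -e.
    by have := conv (p - r) (q - r); rewrite !subr_gt0 => /(_ rp rq) h h'; nra.
  have rq : q <= r by rewrite leNgt -e.
  have {}rq : q < r by rewrite lt_neqAle rq andbT; apply/eqP.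
  have {}rp : p < r by rewrite lt_neqAle rp andbT; apply/eqP.
  by have := conv (r - p) (r - q); rewrite !subr_gt0 => /(_ rp rq) h h'; nra.
- apply: connected_continuous_connected; first exact: segment_connected.
  exact: continuous_subspaceT.
Qed.

End Regions.

(** * Alcoves in coordinates *)

Lemma binS2 (N : nat) : ('C(N.+1, 2) * 2 = N.+1 * N)%N.
Proof. by rewrite bin2 muln2 halfK oddM /= andNb subn0. Qed.

Section Coordinates.
Variables (R : realType) (N : nat).
Implicit Types (x : 'rV[R]_N) (u : 'I_N -> int).

(** The alcove of [u]: since all ordered pairs are included, the pair (j, i) supplies the upper
    bounds on x_i - x_j. *)
Definition fits x u : Prop := forall i j (t : int),
  t * N%:Z < u j - u i -> t%:~R < x ord0 i - x ord0 j.

Definition generic x : Prop :=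
  forall i j, i != j -> forall t : int, x ord0 i - x ord0 j <> t%:~R.

(** A sample point of the alcove: its differences x_i - x_j are exactly (u_j - u_i) / N, and the
    constant makes the coordinates of a window's center sum to 0. *)
Definition center u : 'rV[R]_N :=
  \row_i ((N.+1%:R / 2 - (u i)%:~R) / N%:R).

(* The entry for x_j counts (up to an additive constant) the x_i - t > x_j. *)
Definition rank_window x (j : 'I_N) : int :=
  1 + \sum_i Num.ceil (x ord0 i - x ord0 j).

Lemma fitsE x u i j (t : int) : transversal u -> fits x u -> i != j ->
  (t%:~R < x ord0 i - x ord0 j) = (t * N%:Z < u j - u i).
Proof.
move=> tu fx ij; apply/idP/idP; last exact: fx.
have := transversal_neq t tu ij; case: (ltrgtP (t * N%:Z) (u j - u i)) => // h _.
have : (- t)%:~R < x ord0 j - x ord0 i by apply: fx; rewrite mulNr; lia.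
by rewrite rmorphN /=; lra.
Qed.

Lemma fits_generic x u : transversal u -> fits x u -> generic x.
Proof.
move=> tu fx i j ij t e.
have := fitsE t tu fx ij; rewrite e ltxx => /esym/negbT h.
have ji : j != i by rewrite eq_sym.
have := fitsE (- t) tu fx ji; rewrite rmorphN /= -e opprB ltxx mulNr => /esym/negbT h'.
by have := transversal_neq t tu ij; lia.
Qed.

Lemma fits_center u : (0 < N)%N -> fits (center u) u.
Proof.
move=> N0 i j t h; rewrite !mxE -mulrBl ltr_pdivlMr ?ltr0n //.
have -> : N.+1%:R / 2 - (u i)%:~R - (N.+1%:R / 2 - (u j)%:~R) = (u j - u i)%:~R :> R.
  by rewrite rmorphB /=; ring.
have -> : t%:~R * N%:R = (t * N%:Z)%:~R :> R by rewrite rmorphM.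
by rewrite ltr_int.
Qed.

Lemma sum_center u : (0 < N)%N -> \sum_i u i = ('C(N.+1, 2))%:Z ->
  \sum_i center u ord0 i = 0.
Proof.
move=> N0 su; under eq_bigr do rewrite mxE.
rewrite -mulr_suml sumrB sumr_const card_ord -rmorph_sum /= su.
rewrite (_ : _ - _ = 0) ?mul0r //.
have /(congr1 (fun k : nat => k%:R : R)) := binS2 N.
by rewrite !natrM -mulr_natr -pmulrn; lra.
Qed.

Lemma ceilDN (a : R) : Num.ceil a + Num.ceil (- a) = (a \isn't a Num.int)%:Z.
Proof.
by rewrite [Num.ceil (- a)]ceilNfloor opprK [Num.ceil a]ceil_floor addrAC subrr add0r.
Qed.

(** Compare the two sums term by term: each ceiling grows by at least t, and the term l = i grows by
    more, from 0 to an integer above t. *)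
Lemma rank_window_lt x i j (t : int) : t%:~R < x ord0 i - x ord0 j ->
  t * N%:Z < rank_window x j - rank_window x i.
Proof.
move=> h; rewrite /rank_window.
rewrite (_ : _ - _ = \sum_l Num.ceil (x ord0 l - x ord0 j) -
                     \sum_l Num.ceil (x ord0 l - x ord0 i)); last by ring.
rewrite -sumrB.
have -> : t * N%:Z = \sum_(l < N) t by rewrite sumr_const card_ord -mulr_natr natz.
rewrite (bigD1 i) //= [ltRHS](bigD1 i) //=; apply: ltr_leD.
  by rewrite subrr ceil0 subr0 ceil_gt_int.
apply: ler_sum => l _; rewrite lerBrDr -lerBrDl ceil_le_int rmorphB /=.
by have := ceil_ge (x ord0 l - x ord0 j); lra.
Qed.

Section GenericPoint.
Variable x : 'rV[R]_N.
Hypothesis gx : generic x.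

Lemma generic_cmp i j (t : int) : i != j ->
  t%:~R < x ord0 i - x ord0 j \/ (- t)%:~R < x ord0 j - x ord0 i.
Proof.
move=> ij; have /eqP := gx ij (t := t).
rewrite neq_lt rmorphN /= => /orP[] h; [right|left]; lra.
Qed.

Lemma fits_rank_window : fits x (rank_window x).
Proof.
move=> i j t; have [->|ij] := eqVneq i j.
  by rewrite !subrr ltrz0; nia.
have [//|/rank_window_lt h h'] := generic_cmp t ij.
by move: h h'; rewrite mulNr; lia.
Qed.

Lemma window_rank_window :
  (forall i j : 'I_N, (i < j)%N -> x ord0 j < x ord0 i) ->
  window (rank_window x).
Proof.
move=> dx; split.
- move=> i j ij; rewrite -subr_gt0 -(mul0r N%:Z); apply: rank_window_lt.
  by rewrite subr_gt0 dx.
- move=> i j t e; apply/eqP; apply: contraT => ij.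
  have [] := generic_cmp (- t) ij => /rank_window_lt; rewrite ?opprK ?mulNr; lia.
- pose S := \sum_j \sum_i Num.ceil (x ord0 i - x ord0 j).
  (* Off the integers the ceilings of a and -a add up to 1, so each ordered pair of distinct indices
     contributes 1 to 2 S. *)
  have S2 : S + S = \sum_(j < N) \sum_(i < N) (i != j)%:Z.
    rewrite {2}/S exchange_big /S -big_split; apply: eq_bigr => j _ /=.
    rewrite -big_split; apply: eq_bigr => i _ /=.
    rewrite -(opprB (x ord0 i)) ceilDN; congr (nat_of_bool _)%:Z.
    have [->|ij] := eqVneq i j; first by rewrite subrr int_num0.
    by apply/negP => /intrP[t e]; exact: gx ij _ e.
  have {}S2 : S + S = (N * N.-1)%N%:Z.
    rewrite S2 (eq_bigr (fun=> N.-1%:Z)) => [|j _]; last first.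
      rewrite (bigD1 j) //= eqxx add0r (eq_bigr (fun=> 1)) => [|i ->//]; rewrite sumr_const.
      rewrite (_ : #|_| = N.-1) ?natz //.
      have := cardC1 j; rewrite card_ord => <-; exact: eq_card.
    by rewrite sumr_const card_ord -mulr_natr natz; lia.
  rewrite /rank_window big_split /= sumr_const card_ord -/S.
  have := binS2 N.
  by move: S2; case: (N) => [|k] /=; rewrite -mulr_natr natz; nia.
Qed.

End GenericPoint.

End Coordinates.

(** * Affine permutations and their base windows *)

Definition base_window (N : nat) (w : int -> int) (i : 'I_N) : int := w i.+1%:Z.

Definition perm_of_window (N : nat) (u : 'I_N -> int) : int -> int :=
  of_window N (codom u).

Lemma euclid_uniq (N : nat) (a b s t : int) : 0 <= a < N%:Z -> 0 <= b < N%:Z ->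
  a + s * N%:Z = b + t * N%:Z -> a = b /\ s = t.
Proof.
move=> /andP[a0 aN] /andP[b0 bN] e.
have st : s = t.
  by apply/eqP; rewrite eq_le; apply/andP; split; rewrite leNgt; apply/negP; nia.
by move: e; rewrite st => /addIr.
Qed.

Lemma residue_decomp (N : nat) (z : int) : (0 < N)%N ->
  exists (b : 'I_N) (t : int), z = b.+1%:Z + t * N%:Z.
Proof.
move=> N0; have h0 : 0 <= modz (z - 1) N by apply: modz_ge0; lia.
have h1 : modz (z - 1) N < N by apply: ltz_pmod; lia.
have h2 : (`|modz (z - 1) N| < N)%N by lia.
exists (Ordinal h2), (divz (z - 1) N) => /=.
by have := divz_eq (z - 1) N; lia.
Qed.

Lemma of_window_nth (N : nat) (s : seq int) (i : 'I_N) :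
  base_window (of_window N s) i = nth 0 s i.
Proof.
rewrite /base_window /of_window /level -addn1 PoszD addrK.
rewrite modz_small ?divz_small; last 2 first.
- by rewrite lez_nat ltz_nat /=.
- by rewrite lez_nat ltz_nat /=.
by rewrite mulr0 addr0.
Qed.

Lemma nth_codom_ord (T : Type) x0 N (f : 'I_N -> T) (i : 'I_N) :
  nth x0 (codom f) i = f i.
Proof. by rewrite /codom /image_mem (nth_map i) ?size_enum_ord // nth_ord_enum. Qed.

Lemma base_window_perm N (u : 'I_N -> int) : base_window (perm_of_window u) =1 u.
Proof. by move=> i; rewrite of_window_nth nth_codom_ord. Qed.

Lemma window_base_window N w : min_affine_perm N w -> window (@base_window N w).
Proof.
move=> [bw pw sw iw]; split.
- by move=> i j ij; apply: iw => //; rewrite ltnS ltn_ord.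
- move=> i j t e.
  have wt (x : int) (k : nat) : w (x + k%:Z * N%:Z) = w x + k%:Z * N%:Z.
    elim: k => [|k IH]; first by rewrite !mul0r !addr0.
    by rewrite -addn1 PoszD mulrDl mul1r !addrA pw IH.
  have wz (x : int) : w (x + t * N%:Z) = w x + t * N%:Z.
    have [t0|t0] := lerP 0 t; first by have := wt x `|t|%N; rewrite gez0_abs.
    have := wt (x + t * N%:Z) `|t|%N; rewrite ltz0_abs //.
    rewrite (_ : x + _ + _ = x); last by ring.
    by move=> ->; ring.
  move: e; rewrite /base_window -wz => /(bij_inj bw) e.
  apply: val_inj => /=.
  have := @euclid_uniq N i j 0 t; rewrite !lez_nat !ltz_nat !ltn_ord.
  by move=> /(_ isT isT); lia.
- by rewrite -sw big_add1 /= big_mkord.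
Qed.

(** Distinct residues make the periodic extension injective; occurrence of every residue makes it
    surjective. *)
Lemma perm_of_windowP N (u : 'I_N -> int) : (0 < N)%N -> window u ->
  min_affine_perm N (perm_of_window u).
Proof.
move=> N0 [iu tu su].
have wE (i : 'I_N) (t : int) : perm_of_window u (i.+1%:Z + t * N%:Z) = u i + t * N%:Z.
  rewrite /perm_of_window /of_window /level.
  rewrite (_ : i.+1%:Z + t * N%:Z - 1 = t * N%:Z + i%:Z); last by lia.
  rewrite modzMDl modz_small ?divzMDl; last 2 first.
  - by lia.
  - by rewrite lez_nat ltz_nat /=.
  rewrite divz_small; last by rewrite lez_nat ltz_nat /=.
  by rewrite /= nth_codom_ord addr0 mulrC.
have xE (x : int) := residue_decomp x N0.
have winj : injective (perm_of_window u).
  move=> x y; have [i [t ->]] := xE x; have [j [s ->]] := xE y.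
  rewrite !wE => e.
  have ij : i = j by apply: (tu _ _ (s - t)); rewrite mulrBl; lia.
  by move: e; rewrite ij => /addrI ->.
split.
- have /choice[g gP] : forall z, exists x, perm_of_window u x = z.
    move=> z; have [i [t e]] := transversal_cover z N0 tu.
    exists (i.+1%:Z + (- t) * N%:Z); rewrite wE e; ring.
  by exists g => x //; apply: winj; rewrite gP.
- move=> x; have [i [t ->]] := xE x.
  rewrite -addrA -[X in t * _ + X]mul1r -mulrDl !wE; ring.
- rewrite big_add1 /= big_mkord -su; apply: eq_bigr => i _.
  exact: base_window_perm.
- move=> i j i0 ij jN.
  have h1 : (i.-1 < N)%N by lia.
  have h2 : (j.-1 < N)%N by lia.
  have := base_window_perm u (Ordinal h1); have := base_window_perm u (Ordinal h2).
  rewrite /base_window /= !prednK // => [-> -> |]; last by lia.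
  by apply: iu => /=; lia.
Qed.

Lemma sum_succ_ord (N : nat) : \sum_(b < N) (b.+1%:Z) = ('C(N.+1, 2))%:Z.
Proof.
rewrite -(bin2_sum N.+1) big_mkord big_ord_recl add0n.
by elim/big_rec2: _ => // i a b _ ->; rewrite PoszD.
Qed.

(** * The alcove of an affine permutation as a set of fitting points *)

Section Alcove.
Variables (R : realType) (N : nat) (w : int -> int).
Local Notation u := (@base_window N w).
Hypothesis (N0 : (0 < N)%N) (wu : window u).

Lemma typeA_alcoveP (y : 'rV[R]_N) : fundamental_alcove (typeA R N) y <->
  \sum_i y ord0 i = 0 /\
  forall i j : 'I_N, (i < j)%N -> 0 < y ord0 i - y ord0 j < 1.
Proof.
split=> -[sy hy]; split=> //.
  move=> i j ij; have := hy (delta_mx ord0 i - delta_mx ord0 j).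
  by rewrite dotDr dotNr !dot_delta; apply; exists i, j.
by move=> _ [i [j [ij ->]]]; rewrite dotDr dotNr !dot_delta; exact: hy.
Qed.

Lemma extendE (y : 'rV[R]_N) (b : 'I_N) (s : int) :
  extend y (b.+1%:Z + s * N%:Z) = y ord0 b - s%:~R.
Proof.
rewrite /extend /level (_ : _ - 1 = s * N%:Z + b%:Z); last by lia.
rewrite modzMDl modz_small ?divzMDl; last 2 first.
- by lia.
- by rewrite lez_nat ltz_nat /=.
rewrite divz_small; last by rewrite lez_nat ltz_nat /=.
by rewrite addr0 /= insubT //= => ltbN; congr (y ord0 _ - _); exact: val_inj.
Qed.

(** The action reads x_i = y_b - s when u_i has base b and level s, so the inequalities 0 < y_b -
    y_c < 1 for b < c become those of [fits]. *)
Lemma alcoveAP (x : 'rV[R]_N) :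
  alcoveA w x <-> \sum_i x ord0 i = 0 /\ fits x u.
Proof.
case: wu => iu tu su.
have uE (z : int) := residue_decomp z N0.
(* [f b] is the position in the window of the entry with base b + 1, paired with its level. *)
have /choice[f fP] : forall b : 'I_N, exists p : 'I_N * int,
    u p.1 = b.+1%:Z + p.2 * N%:Z.
  by move=> b; have [i [t e]] := transversal_cover b.+1%:Z N0 tu; exists (i, t).
have finj : injective (fst \o f).
  move=> b c /= e; have := fP b; rewrite e fP => e'; apply: val_inj => /=.
  have := @euclid_uniq N b c (f b).2 (f c).2; rewrite !lez_nat !ltz_nat !ltn_ord.
  by move=> /(_ isT isT); lia.
have fbij : {on [pred _ | true], bijective (fst \o f)}.
  by apply: onW_bij; apply: injF_bij.
have fu (b : 'I_N) i (s : int) : u i = b.+1%:Z + s * N%:Z -> f b = (i, s).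
  move=> e; have := fP b; case: (f b) => i' s' /= e'.
  have ii' : i' = i by apply: (tu _ _ (s' - s)); rewrite e e' mulrBl; lia.
  congr pair => //; move: e'; rewrite ii' e => /addrI /mulIf -> //; lia.
(* The entries and the bases have the same sum, so the levels sum to 0 and the action preserves the
   sum of coordinates. *)
have sf : \sum_b (f b).2 = 0.
  have : \sum_b u (f b).1 = \sum_b u b.
    by rewrite [RHS](reindex (fst \o f)).
  rewrite su (eq_bigr (fun b : 'I_N => b.+1%:Z + (f b).2 * N%:Z)) => [|b _]; last exact: fP.
  rewrite big_split /= sum_succ_ord -mulr_suml => e.
  have /eqP : (\sum_b (f b).2) * N%:Z = 0.
    by apply: (@addrI _ ('C(N.+1, 2))%:Z); rewrite addr0.
  by rewrite mulf_eq0 => /orP[/eqP//|]; lia.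
have sx (y : 'rV[R]_N) : (forall b, y ord0 b = x ord0 (f b).1 + (f b).2%:~R) ->
    \sum_i y ord0 i = \sum_i x ord0 i.
  move=> yE; rewrite (eq_bigr _ (fun b _ => yE b)) big_split /= -rmorph_sum sf.
  by rewrite addr0 [RHS](reindex (fst \o f)).
split.
- move=> [y /typeA_alcoveP[sy hy] yx].
  have xE (b i : 'I_N) (s : int) : u i = b.+1%:Z + s * N%:Z -> x ord0 i = y ord0 b - s%:~R.
    by move=> e; rewrite -yx mxE -/(u i) e extendE.
  split.
    rewrite -(sx y) // => b.
    by rewrite (xE b _ _ (fP b)) subrK.
  move=> i j t; have [b [s ei]] := uE (u i); have [c [s' ej]] := uE (u j).
  rewrite (xE _ _ _ ei) (xE _ _ _ ej) ei ej => ht.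
  have lebN := ltn_ord b; have lecN := ltn_ord c.
  have [bc|cb|bc] := ltngtP b c.
  + have /andP[y0 y1] := hy _ _ bc.
    have : t <= s' - s by rewrite leNgt; apply/negP; nia.
    by rewrite -(ler_int R) rmorphB /=; lra.
  + have /andP[y0 y1] := hy _ _ cb.
    have : t + 1 <= s' - s by rewrite leNgt; apply/negP; nia.
    by rewrite -(ler_int R) rmorphB rmorphD /=; lra.
  + have -> : b = c by exact: val_inj.
    have : t < s' - s by rewrite ltNge; apply/negP; nia.
    by rewrite -(ltr_int R) rmorphB /=; lra.
- move=> [sx0 fx].
  pose y : 'rV[R]_N := \row_b (x ord0 (f b).1 + (f b).2%:~R).
  have yE b : y ord0 b = x ord0 (f b).1 + (f b).2%:~R by rewrite mxE.
  exists y; last first.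
    apply/rowP => i; rewrite mxE -/(u i); have [b [s e]] := uE (u i).
    by rewrite e extendE yE (fu _ _ _ e) /= addrK.
  apply/typeA_alcoveP; split; first by rewrite sx.
  move=> b c bc; rewrite !yE.
  (* This instance yields y_b - y_c > 0; the next one, for the reversed pair and with one level
     subtracted, yields y_b - y_c < 1. *)
  have := fx (f b).1 (f c).1 ((f c).2 - (f b).2).
  have := fx (f c).1 (f b).1 ((f b).2 - (f c).2 - 1).
  rewrite !fP !rmorphB /= => h1 h2.
  have /h1 : ((f b).2 - (f c).2 - 1) * N%:Z <
     b.+1%:Z + (f b).2 * N%:Z - (c.+1%:Z + (f c).2 * N%:Z).
    by rewrite !mulrBl; have := ltn_ord c; lia.
  have /h2 : ((f c).2 - (f b).2) * N%:Z <
     c.+1%:Z + (f c).2 * N%:Z - (b.+1%:Z + (f b).2 * N%:Z).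
    by rewrite !mulrBl; lia.
  by lra.
Qed.

End Alcove.

(** * Minimal alcoves *)

Lemma finite_subset_card_eq (T : choiceType) (A B : set T) :
  finite_set B -> A `<=` B -> B #<= A -> A = B.
Proof.
move=> fB AB BA; have fA := sub_finite_set AB fB.
apply: fset_set_inj => //; apply/eqP; rewrite eqEfcard.
have cA : A #= `I_(size (fset_set A)).
  by rewrite -{1}(fset_setK fA); apply/card_eq_fsetP.
have cB : B #= `I_(size (fset_set B)).
  by rewrite -{1}(fset_setK fB); apply/card_eq_fsetP.
apply/andP; split; first by rewrite -fset_set_sub.
by rewrite -card_le_II -(card_le_eqr cA) -(card_le_eql cB).
Qed.

(** The reciprocal of 1 plus the sum of the reciprocals works, also when [I] is empty. *)
Lemma pos_lower_bound (R : realFieldType) (I : finType) (b : I -> R) :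
  (forall i, 0 < b i) -> exists2 e, 0 < e & forall i, e <= b i.
Proof.
move=> b0.
have s0 : 0 < 1 + \sum_i (b i)^-1.
  by rewrite ltr_pwDl // sumr_ge0 // => i _; rewrite invr_ge0 ltW.
exists (1 + \sum_i (b i)^-1)^-1; first by rewrite invr_gt0.
move=> i; rewrite -[leRHS]invrK lef_pV2 ?posrE ?invr_gt0 //.
rewrite (bigD1 i) //= addrCA lerDl addr_ge0 // sumr_ge0 // => j _.
by rewrite invr_ge0 ltW.
Qed.

Lemma increasing_nonpos N (u : 'I_N -> int) (i j : 'I_N) (t : int) :
  increasing u -> (i < j)%N -> t <= 0 -> t * N%:Z < u j - u i.
Proof. by move=> iu /iu h t0; nia. Qed.

(* Phi obtained from A_{N-1} by restricting the roots along the linear map emb;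
   the dominant alcoves of Phi correspond to the windows satisfying fsym. *)
Record folding (R : realType) (d N : nat) (Phi : posSystem R d) := Folding {
  emb : 'rV[R]_d -> 'rV[R]_N;
  froot : 'I_N -> 'I_N -> 'rV[R]_d;
  fsym : ('I_N -> int) -> Prop;
  emb_linear : forall c x y, emb (c *: x + y) = c *: emb x + emb y;
  ambient_emb : forall x, ambient Phi x <-> \sum_i emb x ord0 i = 0;
  posrootP : forall a, posroot Phi a <->
    exists i j : 'I_N, (i < j)%N /\ a = froot i j;
  dot_froot : forall x (i j : 'I_N), (i < j)%N ->
    dot x (froot i j) = emb x ord0 i - emb x ord0 j;
  fsym_rank : forall x, generic (emb x) -> fsym (rank_window (emb x));
  fsym_center : forall u, window u -> fsym u -> exists x, emb x = center R u;
  fsym_step : forall m u, window u -> fsym u -> ~ mcore m u ->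
    exists v, [/\ window v, fsym v, shi_le m u v /\ shi_le m v u
                & \sum_i v i ^+ 2 < \sum_i u i ^+ 2]
}.

(** * Regions and alcoves of a folded root system *)

Section Folding.
Variables (R : realType) (d N : nat) (Phi : posSystem R d) (F : folding N Phi).
Hypothesis N0 : (0 < N)%N.
Implicit Types (x y : 'rV[R]_d) (u v : 'I_N -> int).

Definition fold_alcove u : set 'rV[R]_d :=
  [set x | ambient Phi x /\ fits (emb F x) u].

Let ambientP x y c : ambient Phi x -> ambient Phi y ->
  ambient Phi (c *: (y - x) + x).
Proof.
move=> /(ambient_emb F) ax /(ambient_emb F) ay; apply/(ambient_emb F).
have -> : y - x = (-1) *: x + y by rewrite scaleN1r addrC.
under eq_bigr do rewrite !emb_linear !mxE.
rewrite big_split /= -mulr_sumr big_split /= -mulr_sumr ax ay; ring.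
Qed.

Let affineP H : affine_arrangement Phi H <->
  exists a k, posroot Phi a /\ H = hyperplane Phi a k.
Proof. by []. Qed.

Let shiQ m a (k : int) := [/\ posroot Phi a, - m%:Z < k & k <= m%:Z].

Let shiP m H : shi_arrangement Phi m H <->
  exists a k, shiQ m a k /\ H = hyperplane Phi a k.
Proof.
split=> [[a [k [h1 h2 h3 h4]]]|[a [k [[h1 h2 h3] h4]]]]; exists a, k => //.
Qed.

Let affine_compl := arr_complementP affineP.
Let shi_compl m := arr_complementP (@shiP m).
Let affine_comp := componentP affineP ambientP.
Let shi_comp m := componentP (@shiP m) ambientP.
Local Notation acompl := (arr_complement Phi (affine_arrangement Phi)).
Local Notation scompl m := (arr_complement Phi (shi_arrangement Phi m)).

Lemma generic_emb x :
  (forall a (k : int), posroot Phi a -> dot x a <> k%:~R) -> generic (emb F x).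
Proof.
move=> gx i j ij t e; case: (ltngtP i j) => [lij|lji|/val_inj/eqP]; last first.
- by rewrite (negbTE ij).
- apply: (gx (froot F j i) (- t)); first by apply/(posrootP F); exists j, i.
  by rewrite dot_froot // rmorphN /= -e opprB.
- apply: (gx (froot F i j) t); first by apply/(posrootP F); exists i, j.
  by rewrite dot_froot.
Qed.

Lemma fits_dot x u a : window u -> fits (emb F x) u -> posroot Phi a ->
  exists i j : 'I_N, [/\ (i < j)%N, a = froot F i j &
    forall t : int, (t%:~R < dot x a) = (t * N%:Z < u j - u i)].
Proof.
move=> [_ tu _] fx /(posrootP F)[i [j [ij ->]]]; exists i, j; split=> // t.
rewrite dot_froot // (fitsE _ tu) //.
by apply: contraTneq ij => ->; rewrite ltnn.
Qed.

Lemma fits_dot_nint x u a (k : int) : window u -> fits (emb F x) u ->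
  posroot Phi a -> dot x a <> k%:~R.
Proof.
move=> [_ tu _] fx /(posrootP F)[i [j [ij ->]]]; rewrite dot_froot //.
apply: (fits_generic tu fx).
by apply: contraTneq ij => ->; rewrite ltnn.
Qed.

Lemma fits_acompl x u : window u -> fold_alcove u x -> acompl x.
Proof.
by move=> wu [ax fx]; apply/affine_compl; split=> // a k pa; exact: (fits_dot_nint wu fx).
Qed.

Lemma fits_scompl m x u : window u -> fold_alcove u x -> scompl m x.
Proof.
by move=> wu [ax fx]; apply/shi_compl; split=> // a k [pa _ _]; exact: (fits_dot_nint wu fx).
Qed.

(** Fitting a window fixes the side of every affine hyperplane, and these sides determine the
    component. *)
Lemma fold_alcoveE x u : window u -> fold_alcove u x ->
  fold_alcove u = connected_component acompl x.
Proof.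
move=> wu ux; have [ax fx] := ux; have cx := fits_acompl wu ux.
have [_ tu _] := wu.
apply/seteqP; split=> y.
  move=> uy; apply/affine_comp => //; split; first exact: fits_acompl uy.
  move=> a k /[dup] pa /(posrootP F)[i [j [ij ->]]]; rewrite !dot_froot //.
  have nij : i != j := ord_lt_neq ij.
  by rewrite (fitsE _ tu) // (fitsE _ tu) //; case: uy.
move=> /(affine_comp _ cx)[/affine_compl[ay ny] side]; split=> // i j t h.
have gy := generic_emb ny.
case: (ltngtP i j) => [ij|ji|/val_inj e].
- have pa : posroot Phi (froot F i j) by apply/(posrootP F); exists i, j.
  by have := side _ t pa; rewrite !dot_froot // => <-; exact: fx.
- have pa : posroot Phi (froot F j i) by apply/(posrootP F); exists j, i.
  have := side _ (- t) pa; rewrite !dot_froot // rmorphN /=.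
  have := fx _ _ _ h; have nij : i != j by rewrite eq_sym; exact: ord_lt_neq.
  have [//|] := generic_cmp gy t nij; rewrite rmorphN /= => -> h1 /esym.
  by rewrite ltrNl; lra.
- by move: h; rewrite e !subrr ltrz0; nia.
Qed.

Lemma fits_shi_component m x y u v : window u -> window v ->
  fold_alcove u x -> fold_alcove v y ->
  connected_component (scompl m) x y <-> shi_le m u v /\ shi_le m v u.
Proof.
move=> wu wv ux vy; have cx := fits_scompl m wu ux.
have [[ax fx] [ay fy]] := (ux, vy); have [[iu tu _] [iv tv _]] := (wu, wv).
have E (i j : 'I_N) (t : int) : (i < j)%N ->
  ((t%:~R < dot x (froot F i j)) = (t * N%:Z < u j - u i)) *
  ((t%:~R < dot y (froot F i j)) = (t * N%:Z < v j - v i)).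
  move=> ij; have nij : i != j := ord_lt_neq ij.
  by rewrite !dot_froot // (fitsE _ tu) // (fitsE _ tv).
split=> [/(shi_comp _ cx)[_ side]|[uv vu]].
  have side' (i j : 'I_N) (t : int) : (i < j)%N -> t <= m%:Z ->
      (t * N%:Z < u j - u i) = (t * N%:Z < v j - v i).
    (* The arrangement only has levels above -m; nonpositive levels are settled by monotonicity. *)
    move=> ij tm; have [t0|t0] := lerP t 0; first by rewrite !increasing_nonpos.
    have := side (froot F i j) t; rewrite !E //; apply; split=> //; last by lia.
    by apply/(posrootP F); exists i, j.
  by split=> i j ij t tm; rewrite side'.
apply/shi_comp => //; split; first exact: fits_scompl vy.
move=> a k [/(posrootP F)[i [j [ij ->]]] _ km]; rewrite !E //.
by apply/idP/idP; [exact: uv|exact: vu].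
Qed.

Lemma dominant_regionW m C x : dominant_region Phi m C -> C x ->
  C = connected_component (scompl m) x.
Proof. by move=> [[x0 _ ->] _] /same_connected_component. Qed.

(** For m > 0 the walls of the dominant chamber belong to the arrangement, so a region inside the
    chamber avoids them. *)
Lemma dominant_point m C x a : (0 < m)%N -> dominant_region Phi m C -> C x ->
  posroot Phi a -> 0 < dot x a.
Proof.
move=> m0 [[x0 cx0 Cx0] CD] Cx pa.
have /shi_compl[_ /(_ a 0) nx] : scompl m x.
  by move: Cx; rewrite Cx0 => /connected_component_sub.
have [_ /(_ a pa)] := CD _ Cx; rewrite le_eqVlt => /orP[/eqP e|//].
by case: nx => //; split=> //; rewrite oppr_lt0 ltz_nat.
Qed.

Lemma dominant_emb m C x (i j : 'I_N) : (0 < m)%N -> dominant_region Phi m C ->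
  C x -> (i < j)%N -> emb F x ord0 j < emb F x ord0 i.
Proof.
move=> m0 dC Cx ij; rewrite -subr_gt0 -dot_froot //.
by apply: (dominant_point m0 dC Cx); apply/(posrootP F); exists i, j.
Qed.

(* Stretching a point of a region slightly leaves the hyperplanes containing it
   without crossing any other one. *)
Lemma dominant_region_alcove m C : (0 < m)%N -> dominant_region Phi m C ->
  exists x u, [/\ C x, window u, fsym F u & fold_alcove u x].
Proof.
move=> m0 dC; have [[x0 cx0 Cx0] CD] := dC.
have C0 : C x0 by rewrite Cx0; exact: connected_component_refl.
pose D (p : 'I_N * 'I_N) := emb F x0 ord0 p.1 - emb F x0 ord0 p.2.
(* The room left below the next integer. For 0 < e <= gap, stretching by 1 + e keeps D p below it;
   the 1 in the denominator gives strictness and avoids a division by 0. *)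
pose gap p := ((Num.floor (D p))%:~R + 1 - D p) / (`|D p| + 1).
have D1 p : 0 < `|D p| + 1 by rewrite ltr_wpDl.
have [p|e e0 eb] := @pos_lower_bound _ _ gap.
  rewrite divr_gt0 // subr_gt0.
  by have := floorD1_gt (D p); rewrite rmorphD.
pose y := e *: x0 + x0.
have yE (i j : 'I_N) : (i < j)%N -> [/\ 0 < D (i, j), (Num.floor (D (i, j)))%:~R <= D (i, j),
    dot x0 (froot F i j) = D (i, j), D (i, j) < dot y (froot F i j) &
    dot y (froot F i j) < (Num.floor (D (i, j)))%:~R + 1].
  move=> ij; have Dp : 0 < D (i, j) by rewrite subr_gt0; exact: (dominant_emb m0 dC).
  have := eb (i, j); rewrite ler_pdivlMr // gtr0_norm // => h.
  have h2 : 0 < e * D (i, j) by rewrite mulr_gt0.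
  have Ey : dot y (froot F i j) = e * D (i, j) + D (i, j).
    by rewrite dot_is_linear dot_froot.
  by split; rewrite ?Ey ?floor_le ?dot_froot //; lra.
have ynint a (k : int) : posroot Phi a -> dot y a <> k%:~R.
  move=> /(posrootP F)[i [j [ij ->]]] E; have [h1 h2 h3 h4 h5] := yE _ _ ij.
  have h6 : (Num.floor (D (i, j)))%:~R < k%:~R :> R by rewrite -E; lra.
  have : k%:~R < (Num.floor (D (i, j)) + 1)%:~R :> R by rewrite -E rmorphD.
  by move: h6; rewrite !ltr_int; lia.
have ay : ambient Phi y.
  have [ax0 _] := CD _ C0; have := ambientP (- e) ax0 (_ : ambient Phi 0).
  rewrite sub0r scaleNr scalerN opprK; apply; apply/(ambient_emb F).
  have -> : (0 : 'rV[R]_d) = (-1) *: 0 + 0 by rewrite scaler0 addr0.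
  by under eq_bigr do rewrite emb_linear scaleN1r addNr mxE; rewrite big1.
have Cy : C y.
  rewrite Cx0; apply/shi_comp => //; split.
    by apply/shi_compl; split=> // a k [pa _ _]; exact: ynint.
  move=> a k qa; have /shi_compl[_ /(_ _ _ qa) nk] := cx0.
  have [/(posrootP F)[i [j [ij ea]]] _ _] := qa; rewrite ea in nk *.
  have [h1 h2 h3 h4 h5] := yE _ _ ij; rewrite h3 in nk *.
  apply/idP/idP => h; first exact: lt_trans h h4.
  have h6 : k < Num.floor (D (i, j)) + 1 by rewrite -(ltr_int R) rmorphD /=; lra.
  have : k <= Num.floor (D (i, j)) by lia.
  rewrite -(ler_int R) => h7; rewrite lt_neqAle (le_trans h7) // andbT.
  by apply/eqP => e'; apply: nk.
have gy := generic_emb ynint.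
exists y, (rank_window (emb F y)); split=> //.
- by apply: window_rank_window => // i j ij; exact: (dominant_emb m0 dC).
- exact: fsym_rank.
- by split=> //; exact: fits_rank_window.
Qed.

Lemma alcove_window m C A : (0 < m)%N -> dominant_region Phi m C ->
  is_alcove Phi A -> A `<=` C ->
  exists u, [/\ window u, fsym F u & A = fold_alcove u].
Proof.
move=> m0 dC [y cy Ay] AC.
have Cy : C y by apply: AC; rewrite Ay; exact: connected_component_refl.
have /affine_compl[ay ny] := cy; have gy := generic_emb ny.
have wu : window (rank_window (emb F y)).
  by apply: window_rank_window => // i j ij; exact: (dominant_emb m0 dC).
exists (rank_window (emb F y)); split=> //; first exact: fsym_rank.
by rewrite Ay (fold_alcoveE (x := y) wu) //; split=> //; exact: fits_rank_window.
Qed.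

Lemma fold_alcove_center u : window u -> fsym F u ->
  exists2 x, fold_alcove u x & emb F x = center R u.
Proof.
move=> wu su; have [x ex] := fsym_center wu su; exists x => //.
case: (wu) => _ _ sumu.
split; last by rewrite ex; exact: fits_center.
by apply/(ambient_emb F); rewrite ex; exact: sum_center.
Qed.

Lemma is_alcove_fold u : window u -> fsym F u -> is_alcove Phi (fold_alcove u).
Proof.
move=> wu su; have [x ux _] := fold_alcove_center wu su.
by exists x; [exact: fits_acompl ux|exact: fold_alcoveE].
Qed.

Lemma fold_alcove_sub m C x u v : window u -> window v ->
  dominant_region Phi m C -> C x -> fold_alcove u x ->
  shi_le m u v /\ shi_le m v u -> fold_alcove v `<=` C.
Proof.
move=> wu wv dC Cx ux uv y vy; rewrite (dominant_regionW dC Cx).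
exact/(fits_shi_component m wu wv ux vy).
Qed.

Lemma fold_alcove_shi m C u v : window u -> window v -> fsym F u -> fsym F v ->
  dominant_region Phi m C -> fold_alcove u `<=` C -> fold_alcove v `<=` C ->
  shi_le m u v.
Proof.
move=> wu wv su sv dC uC vC.
have [x ux _] := fold_alcove_center wu su; have [y vy _] := fold_alcove_center wv sv.
have := vC _ vy; rewrite (dominant_regionW dC (uC _ ux)).
by move=> /(fits_shi_component m wu wv ux vy)[].
Qed.

(** Descent on the sum of squares, a nonnegative integer. *)
Lemma reduce_mcore m u : window u -> fsym F u -> exists v,
  [/\ window v, fsym F v, mcore m v & shi_le m u v /\ shi_le m v u].
Proof.
have [k] := ubnP `|(\sum_i u i ^+ 2)%R|%N; elim: k u => // k IH u uk wu su.
have [cu|cu] := pselect (mcore m u); first by exists u; split=> //; split=> ?.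
have [v [wv sv [uv vu] lt]] := fsym_step wu su cu.
have pos (z : 'I_N -> int) : 0 <= \sum_i z i ^+ 2.
  by apply: sumr_ge0 => i _; exact: sqr_ge0.
have [|v' [wv' sv' cv' [vv' v'v]]] := IH v _ wv sv.
  by have := pos u; have := pos v; lia.
by exists v'; split=> //; split; [exact: shi_le_trans vv'|exact: shi_le_trans v'v _].
Qed.

(** Dominance excludes negative levels, and the alcove lies on one side of each hyperplane, so a
    single point x decides. *)
Lemma separating_fold u x : window u -> fold_alcove u x ->
  separating Phi (fold_alcove u) =
  [set h | [/\ posroot Phi h.1, 0 < h.2 & h.2%:~R < dot x h.1]].
Proof.
move=> wu ux; have [ax fx] := ux; apply/seteqP; split=> -[a k] /= [pa].
  case=> [[k0 hk]|[k0 hk]]; first by split=> //; exact: hk.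
  have [i [j [ij ea E]]] := fits_dot wu fx pa.
  have := hk _ ux; have : k%:~R < dot x a.
    by rewrite E; case: wu => iu _ _; apply: increasing_nonpos => //; apply: ltW.
  by lra.
move=> k0 hk; split=> //; left; split=> // y [ay fy].
have [i [j [ij ea E]]] := fits_dot wu fx pa.
by rewrite /= ea dot_froot //; apply: fy; rewrite -E.
Qed.

Lemma finite_separating u x : window u -> fold_alcove u x ->
  finite_set (separating Phi (fold_alcove u)).
Proof.
move=> wu ux; rewrite (separating_fold wu ux).
(* A common bound for all differences of entries, hence for the levels of separating hyperplanes. *)
pose K := (\sum_(p : 'I_N * 'I_N) `|u p.2 - u p.1|)%N.
apply: (@sub_finite_set _ _
  [set (froot F p.1.1 p.1.2, (nat_of_ord p.2)%:Z) | p in [set: 'I_N * 'I_N * 'I_K.+1]]).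
  move=> -[a k] /= [pa k0]; have [i [j [ij ea E]]] := fits_dot wu ux.2 pa.
  rewrite E => kN.
  have uK : (`|u j - u i| <= K)%N.
    by rewrite /K (bigD1 (i, j)) //= leq_addr.
  have kK : (`|k| < K.+1)%N by nia.
  exists ((i, j), Ordinal kK) => //=; rewrite ea gez0_abs //; lia.
by apply: finite_image; exact: finite_finset.
Qed.

Section MinimalAlcoves.
Variables (m : nat) (C : set 'rV[R]_d).
Hypotheses (m0 : (0 < m)%N) (dC : dominant_region Phi m C).

(** Sharing a region compares the levels up to m; the core condition on [u] extends this to all
    levels, which gives inclusion and not just an inequality of cardinals. *)
Lemma mcore_separating u v : window u -> window v -> fsym F u -> fsym F v ->
  mcore m u -> fold_alcove u `<=` C -> fold_alcove v `<=` C ->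
  separating Phi (fold_alcove u) `<=` separating Phi (fold_alcove v).
Proof.
move=> wu wv su sv cu uC vC.
have le := mcore_shi_le wu wv cu (fold_alcove_shi wu wv su sv dC uC vC).
have [x ux _] := fold_alcove_center wu su; have [y vy _] := fold_alcove_center wv sv.
rewrite (separating_fold wu ux) (separating_fold wv vy) => -[a k] /= [pa k0].
have [/(posrootP F)[i [j [ij ea]]] [iu tu _] [iv tv _]] := And3 pa wu wv.
have nij : i != j := ord_lt_neq ij.
rewrite ea !dot_froot // (fitsE _ tu ux.2) // => /(le _ _ ij) h; split=> //.
  by rewrite -ea.
by rewrite (fitsE _ tv vy.2).
Qed.

Lemma mcore_min_alcove u : window u -> fsym F u -> mcore m u ->
  fold_alcove u `<=` C -> is_min_alcove Phi C (fold_alcove u).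
Proof.
move=> wu su cu uC; split=> //; first exact: is_alcove_fold.
move=> B aB BC; have [v [wv sv eB]] := alcove_window m0 dC aB BC.
rewrite eB in BC *; apply: subset_card_le; exact: mcore_separating.
Qed.

(** Minimality of [v] turns the inclusion of finite separating sets into an equality, and the levels
    determine the window by [window_eq]. *)
Lemma min_alcove_mcore u v : window u -> window v -> fsym F u -> fsym F v ->
  mcore m u -> fold_alcove u `<=` C -> is_min_alcove Phi C (fold_alcove v) ->
  u = v.
Proof.
move=> wu wv su sv cu uC [_ vC vmin].
have [x ux ex] := fold_alcove_center wu su; have [y vy ey] := fold_alcove_center wv sv.
have uv := mcore_separating wu wv su sv cu uC vC.
have := finite_subset_card_eq (finite_separating wv vy) uv.
move=> /(_ (vmin _ (is_alcove_fold wu su) uC)).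
rewrite (separating_fold wu ux) (separating_fold wv vy) => E.
have le := mcore_shi_le wu wv cu (fold_alcove_shi wu wv su sv dC uC vC).
apply/funext; apply: window_eq => // i j ij t h.
have [t0|t0] := lerP t 0.
  by case: wu => iu _ _; exact: increasing_nonpos.
have [[_ tu _] [_ tv _]] := (wu, wv).
have nij : i != j := ord_lt_neq ij.
have pa : posroot Phi (froot F i j) by apply/(posrootP F); exists i, j.
have : [set h | [/\ posroot Phi h.1, 0 < h.2 & h.2%:~R < dot y h.1]] (froot F i j, t).
  by split=> //=; rewrite dot_froot // (fitsE _ tv vy.2).
by rewrite -E => -[_ _] /=; rewrite dot_froot // (fitsE _ tu ux.2).
Qed.

Lemma exists_min_alcove : exists u,
  [/\ window u, fsym F u, mcore m u & is_min_alcove Phi C (fold_alcove u)].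
Proof.
have [x [u [Cx wu su ux]]] := dominant_region_alcove m0 dC.
have [v [wv sv cv uv]] := reduce_mcore m wu su.
exists v; split=> //; apply: mcore_min_alcove => //.
exact: (fold_alcove_sub wu wv dC Cx ux uv).
Qed.

Lemma min_alcoveP v : window v -> fsym F v -> is_min_alcove Phi C (fold_alcove v) ->
  mcore m v.
Proof.
move=> wv sv vmin; have [u [wu su cu [_ uC _]]] := exists_min_alcove.
by rewrite -(min_alcove_mcore wu wv su sv cu uC vmin).
Qed.

Lemma min_alcove_uniq u v : window u -> window v -> fsym F u -> fsym F v ->
  is_min_alcove Phi C (fold_alcove u) -> is_min_alcove Phi C (fold_alcove v) ->
  u = v.
Proof.
move=> wu wv su sv umin; have [_ uC _] := umin.
by apply: min_alcove_mcore => //; exact: min_alcoveP.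
Qed.

End MinimalAlcoves.

Lemma min_alcove_region m C C' u : window u -> fsym F u ->
  dominant_region Phi m C -> dominant_region Phi m C' ->
  is_min_alcove Phi C (fold_alcove u) -> is_min_alcove Phi C' (fold_alcove u) ->
  C = C'.
Proof.
move=> wu su dC dC' [_ uC _] [_ uC' _].
have [x ux _] := fold_alcove_center wu su.
by rewrite (dominant_regionW dC (uC _ ux)) (dominant_regionW dC' (uC' _ ux)).
Qed.

Lemma mcore_region m u : (0 < m)%N -> window u -> fsym F u -> mcore m u ->
  exists2 C, dominant_region Phi m C & is_min_alcove Phi C (fold_alcove u).
Proof.
move=> m0 wu su cu; have [x ux _] := fold_alcove_center wu su.
have cx := fits_scompl m wu ux.
pose C := connected_component (scompl m) x.
have dC : dominant_region Phi m C.
  split; first by exists x.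
  move=> y /(shi_comp _ cx)[/shi_compl[ay _] side]; split=> // a pa.
  have [i [j [ij ea E]]] := fits_dot wu ux.2 pa.
  (* As m > 0, level 0 belongs to the arrangement, so positivity at x carries over to the whole
     component. *)
  have := side a 0; rewrite E mul0r subr_gt0 => h; apply/ltW.
  rewrite -h; first by case: wu => /(_ _ _ ij).
  by split=> //; rewrite oppr_lt0 ltz_nat.
exists C => //; apply: (mcore_min_alcove m0 dC) => //.
have Cx : C x by exact: connected_component_refl.
by apply: (fold_alcove_sub wu wu dC Cx ux); split=> ?.
Qed.

Lemma m_minimal_mcore m u : (0 < m)%N -> window u -> fsym F u ->
  m_minimal Phi m (fold_alcove u) <-> mcore m u.
Proof.
move=> m0 wu su; split=> [[C dC umin]|]; first exact: min_alcoveP umin.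
exact: mcore_region.
Qed.

End Folding.

(** * Types A and C *)

Lemma dot_typeA (R : realType) (n : nat) (x : 'rV[R]_n) (i j : 'I_n) :
  (i < j)%N -> dot x (delta_mx ord0 i - delta_mx ord0 j) = x ord0 i - x ord0 j.
Proof. by rewrite dotDr dotNr !dot_delta. Qed.

(** Transparent, so that [emb] and [fsym] compute to the identity and [True]. *)
Definition foldA (R : realType) (n : nat) : folding n (typeA R n).
Proof.
apply: (@Folding R n n (typeA R n) id
  (fun i j => delta_mx ord0 i - delta_mx ord0 j) (fun _ => True)) => //.
- exact: dot_typeA.
- by move=> u _ _; exists (center R u).
- move=> m u wu _ /(exists_smaller_window wu)[v [wv uv sv]]; exists v; split=> //.
Defined.

(** * Antisymmetric points and the roots of type C *)

Section Antisym.
Variables (R : realType) (n : nat).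
Implicit Types (x : 'rV[R]_n) (X : 'rV[R]_(n + n)).

Lemma rev_lshift (i : 'I_n) : rev_ord (lshift n i) = rshift n (rev_ord i).
Proof. by apply: val_inj => /=; have := ltn_ord i; lia. Qed.

Lemma rev_rshift (i : 'I_n) : rev_ord (rshift n i) = lshift n (rev_ord i).
Proof. by apply: val_inj => /=; have := ltn_ord i; lia. Qed.

Lemma antisymE x i : (antisym x ord0 (lshift n i) = x ord0 i) *
  (antisym x ord0 (rshift n i) = - x ord0 (rev_ord i)).
Proof. by rewrite /antisym row_mxEl row_mxEr mxE. Qed.

Lemma antisym_rev x i : antisym x ord0 (rev_ord i) = - antisym x ord0 i.
Proof.
rewrite -[i]splitK; case: (fintype.split i) => b /=.
  by rewrite rev_lshift !antisymE rev_ordK.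
by rewrite rev_rshift !antisymE opprK.
Qed.

(** The i-th coordinate form of R^{2n} restricted along [antisym]. *)
Definition eps (i : 'I_(n + n)) : 'rV[R]_n :=
  match fintype.split i with
  | inl a => delta_mx ord0 a
  | inr b => - delta_mx ord0 (rev_ord b)
  end.

Lemma dot_eps x i : dot x (eps i) = antisym x ord0 i.
Proof.
rewrite -{2}[i]splitK /eps; case: (fintype.split i) => b /=.
  by rewrite dot_delta antisymE.
by rewrite dotNr dot_delta antisymE.
Qed.

Lemma eps_lshift i : eps (lshift n i) = delta_mx ord0 i.
Proof. by rewrite /eps (unsplitK (inl i)). Qed.

Lemma eps_rshift i : eps (rshift n i) = - delta_mx ord0 (rev_ord i).
Proof. by rewrite /eps (unsplitK (inr i)). Qed.

Lemma antisym_linear (c : R) x y :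
  antisym (c *: x + y) = c *: antisym x + antisym y.
Proof.
apply/rowP => i.
by rewrite [RHS]mxE [X in _ = X + _]mxE -!dot_eps dot_is_linear.
Qed.

Lemma sum_antisym x : \sum_i antisym x ord0 i = 0.
Proof.
rewrite big_split_ord /=.
under eq_bigr do rewrite antisymE.
under [X in _ + X]eq_bigr do rewrite antisymE.
by rewrite sumrN [X in X - _](reindex_inj rev_ord_inj) /= subrr.
Qed.

(** A pair within one half gives e_a - e_b; a pair across the halves gives e_a + e_b, or 2 e_a if
    its members are mirror images. *)
Lemma typeC_posrootP a : posroot (typeC R n) a <->
  exists i j : 'I_(n + n), (i < j)%N /\ a = eps i - eps j.
Proof.
split.
  case=> [[i [j [ij [->|->]]]]|[i ->]].
  - by exists (lshift n i), (lshift n j); rewrite !eps_lshift.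
  - exists (lshift n i), (rshift n (rev_ord j)).
    rewrite eps_lshift eps_rshift rev_ordK opprK; split=> //=.
    by have := ltn_ord i; lia.
  - exists (lshift n i), (rshift n (rev_ord i)).
    rewrite eps_lshift eps_rshift rev_ordK opprK -mulr2n; split=> //=.
    by have := ltn_ord i; lia.
move=> [i [j [ij ->]]]; move: ij.
rewrite -[i]splitK -[j]splitK.
case: (fintype.split i) => a1; case: (fintype.split j) => b1 /= ij.
- by left; exists a1, b1; rewrite !eps_lshift; split=> //; left.
- rewrite eps_lshift eps_rshift opprK.
  case: (ltngtP a1 (rev_ord b1)) => [h|h|/val_inj h].
  + by left; exists a1, (rev_ord b1); split=> //; right.
  + by left; exists (rev_ord b1), a1; split=> //; right; rewrite addrC.
  + by right; exists a1; rewrite -h -mulr2n.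
- by have := ltn_ord b1; lia.
- left; exists (rev_ord b1), (rev_ord a1); rewrite !eps_rshift opprK addrC.
  by split; [have := ltn_ord b1; rewrite /=; lia|left].
Qed.

(** After reversal each ceiling with i != j becomes 1 minus the original one, so the ranks at j and
    at its mirror image add up to N + 1 with N = 2n. *)
Lemma balanced_rank_window X : (forall i, X ord0 (rev_ord i) = - X ord0 i) ->
  generic X -> balanced (rank_window X).
Proof.
move=> aX gX j; rewrite /rank_window (reindex_inj rev_ord_inj) /=.
rewrite (eq_bigr (fun i => (i != j)%:Z - Num.ceil (X ord0 i - X ord0 j))).
  rewrite sumrB (bigD1 j) //= eqxx add0r (eq_bigr (fun=> 1)) => [|i ->//].
  rewrite sumr_const (_ : #|_| = (n + n).-1).
    by rewrite natz; move: (\sum_i _) => S; have := ltn_ord j; lia.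
  by have := cardC1 j; rewrite card_ord => <-; exact: eq_card.
move=> i _; rewrite !aX opprK addrC -(opprB (X ord0 i)).
apply: (@addrI _ (Num.ceil (X ord0 i - X ord0 j))); rewrite ceilDN [RHS]addrC subrK.
congr (nat_of_bool _)%:Z; have [->|ij] := eqVneq i j; first by rewrite subrr int_num0.
by apply/negP => /intrP[t e]; exact: gX ij _ e.
Qed.

Lemma balanced_center u : balanced u -> exists x, antisym x = center R u.
Proof.
move=> bu; exists (\row_i center R u ord0 (lshift n i)); apply/rowP => i.
rewrite -[i]splitK; case: (fintype.split i) => b /=; rewrite antisymE mxE //.
have -> : rshift n b = rev_ord (lshift n (rev_ord b)) by rewrite rev_lshift rev_ordK.
by rewrite !mxE bu rmorphB /= -pmulrn -mulNr; congr (_ / _); lra.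
Qed.

End Antisym.

Definition foldC (R : realType) (n : nat) : folding (n + n) (typeC R n).
Proof.
apply: (@Folding R n (n + n) (typeC R n) (@antisym R n)
  (fun i j => eps R i - eps R j) (@balanced (n + n))).
- exact: antisym_linear.
- by move=> x; split=> // _; exact: sum_antisym.
- exact: typeC_posrootP.
- by move=> x i j _; rewrite dotDr dotNr !dot_eps.
- by move=> x gx; apply: balanced_rank_window => // i; exact: antisym_rev.
- by move=> u _; exact: balanced_center.
- exact: exists_smaller_balanced.
Defined.

Lemma alcoveA_fold (R : realType) (n : nat) w : (0 < n)%N ->
  window (@base_window n w) ->
  alcoveA (R := R) w = fold_alcove (foldA R n) (base_window w).
Proof.
by move=> n0 wu; apply/seteqP; split=> x /(alcoveAP n0 wu).
Qed.

Lemma alcoveC_fold (R : realType) (n : nat) w : (0 < n)%N ->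
  window (@base_window (n + n) w) ->
  alcoveC (R := R) w = fold_alcove (foldC R n) (base_window w).
Proof.
move=> n0 wu; have N0 : (0 < n + n)%N by lia.
apply/seteqP; split=> x; first by move=> /(alcoveAP N0 wu)[].
by move=> [_ fx]; apply/(alcoveAP N0 wu); split=> //; exact: sum_antisym.
Qed.

(** * Level vectors and doubling *)

Section Level.
Variables (N : nat) (u : 'I_N -> int).
Hypotheses (N0 : (0 < N)%N) (tu : transversal u).

(* The (signed) number of steps N from z up to the entry of u congruent to z;
   for z in {1, ..., N} it is the entry of the level vector with base z. *)
Definition lev (z : int) : int :=
  if [pick i | (N%:Z %| u i - z)%Z] is Some i then divz (u i - z) N else 0.

Lemma levP z : exists i, u i = z + lev z * N%:Z.
Proof.
rewrite /lev; case: pickP => [i /dvdzP[t e]|none].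
  by exists i; rewrite e mulzK ?(addrC z) -?e ?subrK //; lia.
have [i [t e]] := transversal_cover z N0 tu.
have /dvdzP[] := negbT (none i).
by exists t; rewrite e; ring.
Qed.

Lemma lev_eq i z t : u i = z + t * N%:Z -> lev z = t.
Proof.
move=> e; have [j ej] := levP z.
have ij : i = j by apply: (tu (t := t - lev z)); rewrite e ej; ring.
by move: e; rewrite ij ej => /addrI/mulIf; apply; lia.
Qed.

Lemma lev_window i : lev (u i) = 0.
Proof. by apply: (@lev_eq i); rewrite mul0r addr0. Qed.

Lemma levD z t : lev (z + t * N%:Z) = lev z - t.
Proof.
by have [i ei] := levP z; apply: (@lev_eq i); rewrite ei; ring.
Qed.

(** Since lev 0 = lev N + 1, the cases z = 1, ..., N - 1 and z = 0 are the inequalities beta_{i+1} -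
    beta_i <= m and beta_1 - beta_N - 1 <= m; the other z are translates. *)
Lemma mcore_lev m : mcore m u <-> forall z, lev (z + 1) <= lev z + m%:Z.
Proof.
split=> [cu z|h i].
  have [i ei] := levP (z + 1); have [j [t [tm ej]]] := cu i.
  have := @lev_eq j z (lev (z + 1) - t); rewrite ej ei => -> //; last by ring.
  by lia.
have := h (u i - 1); rewrite subrK lev_window => h1.
have [j ej] := levP (u i - 1); exists j, (- lev (u i - 1)).
by split; [lia|rewrite ej; ring].
Qed.

End Level.

Lemma lev_balanced N (u : 'I_N -> int) z : (0 < N)%N -> transversal u ->
  balanced u -> lev u (N.+1%:Z - z) = - lev u z.
Proof.
move=> N0 tu bu; have [i ei] := levP N0 tu z.
by apply: (@lev_eq _ _ N0 tu (rev_ord i)); rewrite bu ei; ring.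
Qed.

(** * Windows obtained by sorting a list *)

Definition sort_window (N : nat) (s : seq int) (i : 'I_N) : int :=
  nth 0 (sort <=%R s) i.

Section SortWindow.
Variables (N : nat) (s : seq int).
Hypothesis sN : size s = N.

Lemma mem_sort_window i : @sort_window N s i \in s.
Proof. by rewrite -(mem_sort <=%R) mem_nth // size_sort sN. Qed.

Lemma sort_window_mem x : x \in s -> exists i, @sort_window N s i = x.
Proof.
rewrite -(mem_sort <=%R) => xs.
have h : (index x (sort <=%R s) < N)%N by rewrite -sN -(size_sort <=%R) index_mem.
by exists (Ordinal h); rewrite /sort_window /= nth_index.
Qed.

Lemma sort_window_sum : \sum_i @sort_window N s i = \sum_(x <- s) x.
Proof.
rewrite -(perm_big _ (permEl (perm_sort <=%R s))) /= (big_nth 0) size_sort sN.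
by rewrite big_mkord.
Qed.

Hypothesis us : uniq s.

Lemma sort_window_incr : increasing (@sort_window N s).
Proof.
move=> i j ij; apply: (sorted_ltn_nth lt_trans) => //.
- by rewrite sort_lt_sorted.
- by rewrite inE size_sort sN.
- by rewrite inE size_sort sN.
Qed.

Lemma sort_window_trans :
  (forall x y t, x \in s -> y \in s -> x = y + t * N%:Z -> x = y) ->
  transversal (@sort_window N s).
Proof.
move=> h i j t e; apply: val_inj; apply/eqP.
have := h _ _ t (mem_sort_window i) (mem_sort_window j) e => /eqP.
by rewrite /sort_window nth_uniq ?size_sort ?sN ?sort_uniq.
Qed.

End SortWindow.

Lemma codom_sort_window N (u : 'I_N -> int) s : increasing u ->
  {subset s <= codom u} -> uniq s -> size s = N -> u = sort_window s.
Proof.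
move=> iu su us sN.
have su' : sorted <%R (codom u).
  apply/(sortedP 0) => i; rewrite size_codom card_ord => iN.
  have iN' : (i < N)%N by exact: ltnW.
  have := nth_codom_ord 0 u (Ordinal iN); have := nth_codom_ord 0 u (Ordinal iN').
  by move=> /= -> ->; exact: iu.
have e : sort <=%R s = codom u.
  have uc : uniq (codom u) by exact: lt_sorted_uniq su'.
  rewrite -[RHS](@sort_le_id _ _ (codom u)); last exact: sub_sorted (@ltW _ _) _ su'.
  apply/perm_sort_leP; apply: uniq_perm => //.
  by have [|] := uniq_min_size us su; rewrite // size_codom card_ord sN.
by apply/funext => i; rewrite /sort_window e nth_codom_ord.
Qed.

(** * Balanced windows from level vectors in Z^n *)

Section Doubling.
Variable n : nat.
Hypothesis n0 : (0 < n)%N.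
Implicit Type g : int -> int.
Local Notation N := (n + n)%N.

Let N0 : (0 < N)%N. Proof. by lia. Qed.

Definition double_entry g (r : nat) : int := r%:Z + N%:Z * g r%:Z.

(** The entries with bases 1, ..., n and their mirror images, whose bases are n + 1, ..., 2n; thus
    [g] is the first half of the level vector. *)
Definition double_seq g : seq int :=
  [seq double_entry g r | r <- iota 1 n] ++
  [seq N.+1%:Z - double_entry g r | r <- iota 1 n].

Definition double_window g : 'I_N -> int := sort_window (double_seq g).

Lemma eq_double_window g h : (forall r : nat, (0 < r <= n)%N -> g r%:Z = h r%:Z) ->
  double_window g = double_window h.
Proof.
move=> gh; rewrite /double_window; congr sort_window; rewrite /double_seq.
by congr cat; apply/eq_in_map => r; rewrite mem_iota add1n ltnS => /gh;
  rewrite /double_entry => ->.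
Qed.

Lemma size_double_seq g : size (double_seq g) = N.
Proof. by rewrite size_cat !size_map size_iota. Qed.

Lemma mem_double_seq g x : reflect (exists2 r : nat, (0 < r <= n)%N &
  x = double_entry g r \/ x = N.+1%:Z - double_entry g r) (x \in double_seq g).
Proof.
apply: (iffP idP) => [|[r rn [->|->]]]; rewrite mem_cat.
- by move=> /orP[] /mapP[r]; rewrite mem_iota add1n ltnS => rn ->; exists r => //;
    [left|right].
- by rewrite (map_f (double_entry g)) // mem_iota add1n ltnS.
- by rewrite orbC (map_f (fun r => N.+1%:Z - double_entry g r)) // mem_iota add1n ltnS.
Qed.

Lemma double_entry_inj g (r s : nat) (t : int) : (0 < r <= n)%N -> (0 < s <= n)%N ->
  double_entry g r = double_entry g s + t * N%:Z -> r = s.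
Proof.
move=> rn sn e.
have [] := @euclid_uniq N (r%:Z - 1) (s%:Z - 1) (g r) (g s + t); [lia|lia| |lia].
by move: e; rewrite /double_entry mulrDl ![N%:Z * _]mulrC; lia.
Qed.

Lemma double_entry_neq g (r s : nat) (t : int) : (0 < r <= n)%N -> (0 < s <= n)%N ->
  double_entry g r <> N.+1%:Z - double_entry g s + t * N%:Z.
Proof.
move=> rn sn e.
have [] := @euclid_uniq N (r%:Z - 1) (N%:Z - s%:Z) (g r) (- g s + t); [lia|lia| |lia].
by move: e; rewrite /double_entry mulrDl ![N%:Z * _]mulrC; lia.
Qed.

Lemma double_seq_trans g x y t : x \in double_seq g -> y \in double_seq g ->
  x = y + t * N%:Z -> x = y.
Proof.
move=> /mem_double_seq[r rn [->|->]] /mem_double_seq[s sn [->|->]] e.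
- by rewrite (double_entry_inj rn sn e).
- by have := double_entry_neq rn sn e.
- by case: (@double_entry_neq g s r (- t)) => //; rewrite mulNr; lia.
- by rewrite (@double_entry_inj g r s (- t)) // mulNr; lia.
Qed.

Lemma uniq_double_seq g : uniq (double_seq g).
Proof.
have inj r s : (0 < r <= n)%N -> (0 < s <= n)%N ->
    double_entry g r = double_entry g s -> r = s.
  by move=> rn sn e; apply: (@double_entry_inj g r s 0) => //; rewrite e; lia.
rewrite cat_uniq !map_inj_in_uniq ?iota_uniq ?andbT /=.
- apply/hasPn => x /mapP[r + ->]; rewrite mem_iota add1n ltnS => rn.
  apply/negP => /mapP[s]; rewrite mem_iota add1n ltnS => sn e.
  by apply: (@double_entry_neq g s r 0) => //; rewrite -e mul0r addr0.
- move=> r s; rewrite !mem_iota !add1n !ltnS => rn sn e.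
  by apply: inj => //; lia.
- by move=> r s; rewrite !mem_iota !add1n !ltnS; exact: inj.
Qed.

Lemma window_double g : window (double_window g).
Proof.
split.
- by apply: sort_window_incr; [exact: size_double_seq|exact: uniq_double_seq].
- apply: sort_window_trans; [exact: size_double_seq|exact: uniq_double_seq|].
  exact: double_seq_trans.
- rewrite sort_window_sum ?size_double_seq // big_cat /= !big_map sumrB.
  rewrite addrC subrK big_const_seq count_predT size_iota iter_addr_0 -mulr_natr natz.
  have := binS2 N.
  by lia.
Qed.

(** The mirror image of the window is increasing with the same set of entries, hence is the window
    itself. *)
Lemma balanced_double g : balanced (double_window g).
Proof.
have [iu _ _] := window_double g.
pose v i := N.+1%:Z - double_window g (rev_ord i).
have e : v = double_window g.
  apply: codom_sort_window (uniq_double_seq g) (size_double_seq g).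
    move=> i j ij; rewrite ltrD2l ltrN2; apply: iu => /=.
    by have := ltn_ord j; lia.
  move=> x xs; have /(sort_window_mem (size_double_seq g))[i ei] :
      N.+1%:Z - x \in double_seq g.
    have /mem_double_seq[r rn [->|->]] := xs; apply/mem_double_seq; exists r => //.
      by right.
    by left; ring.
  apply/codomP; exists (rev_ord i); rewrite /v rev_ordK /double_window ei; ring.
by move=> i; rewrite -{2}e /v; ring.
Qed.

Lemma lev_double g (r : nat) : (0 < r <= n)%N -> lev (double_window g) r%:Z = g r%:Z.
Proof.
move=> rn; have [_ tu _] := window_double g.
have /(sort_window_mem (size_double_seq g))[i ei] : double_entry g r \in double_seq g.
  by apply/mem_double_seq; exists r => //; left.
by apply: (@lev_eq _ _ N0 tu i); rewrite /double_window ei /double_entry mulrC.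
Qed.

Lemma double_window_lev (u : 'I_N -> int) : window u -> balanced u ->
  double_window (lev u) = u.
Proof.
move=> [iu tu _] bu; apply/esym.
apply: codom_sort_window (uniq_double_seq _) (size_double_seq _) => //.
move=> x /mem_double_seq[r rn h]; have [i ei] := levP N0 tu r.
apply/codomP; case: h => ->.
  by exists i; rewrite ei /double_entry; ring.
by exists (rev_ord i); rewrite bu ei /double_entry; ring.
Qed.

(** For the level vector (g_1, ..., g_n, -g_n, ..., -g_1) the middle step is -2 g_n and the
    wrap-around step is 2 g_1 - 1; the second half mirrors the first. *)
Lemma mcore_double m g : mcore m (double_window g) <->
  [/\ forall r : nat, (0 < r < n)%N -> g r.+1%:Z <= g r%:Z + m%:Z,
      2 * g 1 <= m%:Z + 1 & - m%:Z <= 2 * g n%:Z].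
Proof.
have [_ tu _] := window_double g; have bu := balanced_double g.
have levr (r : nat) := @lev_double g r.
move: (double_window g) tu bu levr => u tu bu levr.
have levN z : lev u (N.+1%:Z - z) = - lev u z by exact: lev_balanced.
have g1 : lev u 1 = g 1 by exact: (levr 1%N).
have lev0 : lev u 0 = 1 - g 1.
  have := levN 1; rewrite g1 (_ : N.+1%:Z - 1 = 0 + 1 * N%:Z); last by lia.
  by rewrite levD //; move: (lev u 0) => a; lia.
have levn1 : lev u n.+1%:Z = - g n%:Z.
  by rewrite -levr ?n0 ?leqnn // -levN; congr lev; lia.
rewrite (mcore_lev N0 tu); split=> [h|[h1 h2 h3] z].
  split.
  - move=> r rn; have := h r%:Z; rewrite (_ : r%:Z + 1 = r.+1%:Z); last by lia.
    by rewrite !levr; lia.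
  - by have := h 0; rewrite add0r g1 lev0; lia.
  - have := h n%:Z; rewrite (_ : n%:Z + 1 = n.+1%:Z); last by lia.
    by rewrite levn1 levr; lia.
have E1 : lev u z = lev u (modz z N) - divz z N.
  by rewrite {1}(divz_eq z N) addrC levD.
have E2 : lev u (z + 1) = lev u (modz z N + 1) - divz z N.
  by rewrite {1}(divz_eq z N) -addrA addrC levD.
rewrite E1 E2 [leRHS]addrAC lerD2r {E1 E2}.
have b0 : 0 <= modz z N by apply: modz_ge0; lia.
have bN : modz z N < N%:Z by apply: ltz_pmod; lia.
have [b eb] : exists b : nat, modz z N = b%:Z by exists `|modz z N|%N; lia.
rewrite eb in b0 bN *; move: bN; rewrite ltz_nat => bN.
rewrite (_ : b%:Z + 1 = b.+1%:Z); last by lia.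
have [b1|b1] := posnP b; first by rewrite b1 lev0 g1; lia.
have [bn|nb|bn] := ltngtP b n.
- by rewrite !levr; [apply: h1; lia|lia..].
- have -> : b.+1%:Z = N.+1%:Z - (N - b)%N%:Z by lia.
  have -> : b%:Z = N.+1%:Z - (N - b).+1%:Z by lia.
  rewrite !levN !levr; [|lia..].
  by have := h1 (N - b)%N; lia.
- by rewrite bn levn1 levr; lia.
Qed.

End Doubling.

(** * Admissible shifts *)

(** An entry W i + k has base r and level t iff W i = (r - k) + t n, so [lev W (r - k)] is the level
    of base r in the k-shift. *)
Definition shift_double (n : nat) (W : 'I_n -> int) (k : int) : 'I_(n + n) -> int :=
  double_window (fun r => lev W (r - k)).

Lemma base_levelE (n : nat) (r t : int) : (0 < n)%N -> 1 <= r <= n%:Z ->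
  base n (r + t * n%:Z) = r /\ level n (r + t * n%:Z) = t.
Proof.
move=> n0 rn; rewrite /base /level (_ : _ - 1 = t * n%:Z + (r - 1)); last by ring.
have rn1 : 0 <= r - 1 < n%:Z by lia.
by rewrite modzMDl modz_small // divzMDl ?divz_small //; lia.
Qed.

(** [expansion] runs over the positions of the shifted window and [double_seq] over its bases; the
    lists agree up to order. *)
Lemma expansion_window n w k : (0 < n)%N -> window (@base_window n w) ->
  @base_window (n + n) (expansion n w k) = shift_double (base_window w) k.
Proof.
move=> n0 [iW tW _]; set W := base_window w in iW tW *.
apply/funext => i; rewrite of_window_nth /shift_double /double_window /sort_window.
congr (nth 0 _ i); apply/perm_sort_leP.
set g := fun r : int => lev W (r - k).
pose v := [seq r%:Z + g r%:Z * n%:Z | r <- iota 1 n].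
pose f a := base n a + (2 * n)%N%:Z * level n a.
pose f' a := ((2 * n).+1%:Z - base n a) - (2 * n)%N%:Z * level n a.
have gE (r : nat) : r \in iota 1 n ->
    base n (r%:Z + g r%:Z * n%:Z) = r%:Z /\ level n (r%:Z + g r%:Z * n%:Z) = g r%:Z.
  by rewrite mem_iota => rn; apply: base_levelE => //; lia.
have -> : double_seq n g = [seq f a | a <- v] ++ [seq f' a | a <- v].
  rewrite /double_seq /v -!map_comp; congr cat; apply/eq_in_map => r /gE[/= e1 e2];
    rewrite /f /f' e1 e2 /double_entry mul2n -addnn //; ring.
suff p : perm_eq (shift_window n w k) v.
  by apply: perm_cat; exact: perm_map.
have uv : uniq v.
  rewrite map_inj_in_uniq ?iota_uniq // => r s rn sn /= e.
  have [e1 _] := gE _ rn; have [e2 _] := gE _ sn.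
  by rewrite e e2 in e1; case: e1.
have sv : {subset v <= shift_window n w k}.
  move=> _ /mapP[r rn ->]; have [j ej] := levP n0 tW (r%:Z - k).
  apply/mapP; exists j.+1; first by rewrite mem_iota /= add1n ltnS ltn_ord.
  by have := ej; rewrite /W /base_window /g => ->; ring.
have szv : size (shift_window n w k) = size v by rewrite !size_map.
have [|_ vs] := uniq_min_size uv sv; first by rewrite szv.
by apply: uniq_perm => //; rewrite (leq_size_uniq uv sv) ?szv.
Qed.

(** The levels determine the set of entries of the shifted window; the normalised sum of [W] then
    determines k. *)
Lemma shift_double_inj n (W V : 'I_n -> int) k l : (0 < n)%N ->
  window W -> window V -> shift_double W k = shift_double V l -> W = V /\ k = l.
Proof.
move=> n0 [iW tW sW] [iV tV sV] e.
have levE z : lev W (z - k) = lev V (z - l).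
  have h (r : nat) : (0 < r <= n)%N -> lev W (r%:Z - k) = lev V (r%:Z - l).
    by move=> rn; have := lev_double n0 (fun r => lev W (r - k)) rn;
      rewrite -/(shift_double W k) e lev_double.
  have [b [q zE]] := residue_decomp z n0; have bn : (0 < b.+1 <= n)%N := ltn_ord b.
  by rewrite zE ![_ + _ - _]addrAC !levD // h.
have /choice[f fP] : forall i, exists j, V j = W i + (k - l).
  move=> i; have [j ej] := levP n0 tV (W i + k - l).
  by exists j; rewrite ej -levE addrK lev_window //; ring.
have finj : injective f.
  move=> i j eij; apply: (tW _ _ 0); have := fP i; rewrite eij fP; lia.
have kl : k = l.
  have : \sum_i V (f i) = \sum_i V i by rewrite [RHS](reindex_inj finj).
  rewrite (eq_bigr _ (fun i _ => fP i)) big_split /= sW sV sumr_const card_ord.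
  rewrite -[RHS]addr0 => /addrI/eqP; rewrite mulrn_eq0 eqn0Ngt n0 /=.
  by rewrite subr_eq0 => /eqP.
split=> //; rewrite (codom_sort_window iV (s := codom W)); first 1 last.
- by move=> _ /codomP[i ->]; apply/codomP; exists (f i); rewrite fP kl subrr addr0.
- by apply/injectiveP => i j h; apply: (tW _ _ 0); rewrite h mul0r addr0.
- by rewrite size_codom card_ord.
apply: codom_sort_window => //; last by rewrite size_codom card_ord.
by apply/injectiveP => i j h; apply: (tW _ _ 0); rewrite h mul0r addr0.
Qed.

Lemma shift_double_surj n m (u : 'I_(n + n) -> int) : (0 < n)%N ->
  window u -> balanced u -> mcore m u ->
  exists W k, [/\ window W, mcore m W & shift_double W k = u].
Proof.
move=> n0 wu bu; rewrite -(double_window_lev n0 wu bu); set g := lev u => cu.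
(* Forced: the integers r + n g_r - k must sum to the sum of 1, ..., n. *)
pose k := \sum_(r <- iota 1 n) g r%:Z.
pose s := [seq r%:Z + g r%:Z * n%:Z - k | r <- iota 1 n].
have ss : size s = n by rewrite size_map size_iota.
have inj (r r' : nat) (t : int) : r \in iota 1 n -> r' \in iota 1 n ->
    r%:Z + g r%:Z * n%:Z - k = r'%:Z + g r'%:Z * n%:Z - k + t * n%:Z -> r = r'.
  rewrite !mem_iota => rn rn' e.
  have [] := @euclid_uniq n (r%:Z - 1) (r'%:Z - 1) (g r) (g r' + t);
    [lia|lia|rewrite mulrDl; lia|lia].
have us : uniq s.
  rewrite map_inj_in_uniq ?iota_uniq // => r r' rn rn' e.
  by apply: (inj r r' 0) => //; rewrite e mul0r addr0.
pose W : 'I_n -> int := sort_window s.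
have tW : transversal W.
  apply: sort_window_trans => // _ _ t /mapP[r rn ->] /mapP[r' rn' ->] e.
  by rewrite (inj _ _ _ rn rn' e).
have wW : window W.
  split=> //; first exact: sort_window_incr.
  rewrite sort_window_sum // big_map sumrB big_split /= -mulr_suml -/k.
  rewrite big_const_seq count_predT size_iota iter_addr_0 -mulr_natr natz addrK.
  rewrite -(sum_succ_ord n) -(big_mkord xpredT (fun i => i.+1%:Z)).
  by rewrite /index_iota subn0 -[1%N]addn0 iotaDl big_map.
have levW (r : nat) : (0 < r <= n)%N -> lev W (r%:Z - k) = g r%:Z.
  move=> rn; have /(sort_window_mem ss)[i ei] : r%:Z + g r%:Z * n%:Z - k \in s.
    by apply/mapP; exists r => //; rewrite mem_iota add1n ltnS.
  by apply: (@lev_eq _ _ n0 tW i); rewrite /W ei; ring.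
exists W, k; split=> //; last exact: eq_double_window.
have [h1 h2 h3] := (mcore_double n0 m g).1 cu.
apply/(mcore_lev n0 tW) => z.
have [b [q zkE]] := residue_decomp (z + k) n0.
have [r er] : exists r, r = b.+1 by exists b.+1.
have rn : (0 < r <= n)%N by rewrite er ltn_ord.
rewrite -er in zkE.
have zE : z = (r%:Z - k) + q * n%:Z by lia.
rewrite zE addrAC !levD // [leRHS]addrAC lerD2r levW //.
have [rn'|rn'] := ltnP r n.
  by rewrite (_ : r%:Z - k + 1 = r.+1%:Z - k) ?levW; [apply: h1|..]; lia.
(* At the wrap-around, the two end conditions of type C give 2 (g_1 - g_n) <= 2 m + 1, which implies
   g_1 - 1 <= g_n + m. *)
have -> : r = n by lia.
have -> : n%:Z - k + 1 = 1%N%:Z - k + 1 * n%:Z by lia.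
have {}h2 : 2 * g 1%N%:Z <= m%:Z + 1 := h2; rewrite levD // levW //.
by move: (g 1%N%:Z) (g n%:Z) h2 h3 => x y; lia.
Qed.

Section Admissible.
Variables (n m : nat) (W : 'I_n -> int).
Hypotheses (n0 : (0 < n)%N) (wW : window W) (cW : mcore m W).
Local Notation M := (m * n + 1)%N.

Let tW : transversal W. Proof. by case: wW. Qed.

(** One threshold serves both end conditions: at -k it says -m <= 2 g_n, and at -k + M it says that
    2 g_1 <= m + 1 fails, where g_r = lev W (r - k). *)
Let high (j : int) := 1 - (m./2)%:Z <= lev W j.

(** Adding 1 raises the level by at most m, and adding m n lowers it by exactly m. *)
Let high_down (j : int) : high (j + M%:Z) -> high j.
Proof.
have -> : j + M%:Z = (j + 1) + m%:Z * n%:Z by lia.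
have := (mcore_lev n0 tW m).1 cW j.
by rewrite /high levD //; move: (lev W (j + 1)) (lev W j) => a b; lia.
Qed.

Let high_downs (t : nat) (j : int) : high (j + t%:Z * M%:Z) -> high j.
Proof.
elim: t j => [|t IH] j; first by rewrite mul0r addr0.
by move=> h; apply/high_down/IH; rewrite (_ : _ + _ = j + t.+1%:Z * M%:Z) //; lia.
Qed.

(** The inner inequalities are inherited from the core [W]; only the two end conditions restrict
    k. *)
Lemma mcore_shift_double (k : int) :
  mcore m (shift_double W k) <-> high (- k) && ~~ high (- k + M%:Z).
Proof.
rewrite /shift_double (mcore_double n0).
have -> : high (- k + M%:Z) = (m%:Z + 1 < 2 * lev W (1 - k)).
  rewrite /high (_ : - k + M%:Z = (1 - k) + m%:Z * n%:Z); last by lia.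
  by rewrite levD //; move: (lev W _) => a; have := odd_double_half m; lia.
have -> : high (- k) = (- m%:Z <= 2 * lev W (n%:Z - k)).
  rewrite /high (_ : n%:Z - k = - k + 1 * n%:Z); last by lia.
  by rewrite levD //; move: (lev W _) => a; have := odd_double_half m; lia.
rewrite -leNgt; split=> [[_ h2 h3]|/andP[h3 h2]]; first by apply/andP.
split=> // r rn; have := (mcore_lev n0 tW m).1 cW (r%:Z - k).
by rewrite (_ : r%:Z - k + 1 = r.+1%:Z - k) //; lia.
Qed.

(* high is closed under subtracting M and eventually false, so it drops exactly
   once in every residue class modulo M. *)
Lemma admissible_seq : exists s : seq int, [/\ sorted <%R s, size s = M &
  forall k, mcore m (shift_double W k) <-> k \in s].
Proof.
have ex (c : 'I_M) : exists t : int, mcore m (shift_double W (c%:Z + t * M%:Z)).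
  (* Moving by n B M changes the level by B M >= B, enough to pass the threshold either way. *)
  pose B := (`|lev W (- c%:Z)| + m).+1.
  have BM : (B <= B * M)%N by rewrite leq_pmulr // addn1.
  have hi : high (- c%:Z - (n * B)%N%:Z * M%:Z).
    rewrite /high (_ : _ - _ = - c%:Z + (- (B * M)%N%:Z) * n%:Z); last by lia.
    by rewrite levD //; move: (B * M)%N BM => X; rewrite /B; move: (lev W _) => a; lia.
  have lo : ~~ high (- c%:Z - (n * B)%N%:Z * M%:Z + (2 * n * B)%N%:Z * M%:Z).
    rewrite /high (_ : _ + _ = - c%:Z + ((B * M)%N%:Z) * n%:Z); last by lia.
    by rewrite levD //; move: (B * M)%N BM => X; rewrite /B; move: (lev W _) => a; lia.
  pose P (t : nat) := ~~ high (- c%:Z - (n * B)%N%:Z * M%:Z + t%:Z * M%:Z).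
  have exP : exists t, P t by exists (2 * n * B)%N.
  case: (ex_minnP exP) => t Pt tmin.
  have t0 : (0 < t)%N.
    by rewrite lt0n; apply/eqP => t0; move: Pt; rewrite /P t0 mul0r addr0 hi.
  (* Chosen so that -k is the last point, at step t - 1, before [high] first fails. *)
  exists ((n * B)%N%:Z - t%:Z + 1); apply/mcore_shift_double; apply/andP; split.
    have : ~~ P t.-1 by apply/negP => /tmin; lia.
    by rewrite /P negbK (_ : t.-1%:Z = t%:Z - 1); [congr high; ring|lia].
  by move: Pt; rewrite /P; congr (~~ high _); ring.
have /choice[f fP] := ex.
pose F (c : 'I_M) := c%:Z + f c * M%:Z.
(* Were t positive, [high] at -k would descend to the point M above -(k + t M), where admissibility
   of the second shift makes it fail. *)
have uniqK (k : int) (t : nat) : mcore m (shift_double W k) ->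
    mcore m (shift_double W (k + t%:Z * M%:Z)) -> t = 0%N.
  case: t => // t /mcore_shift_double/andP[h1 _] /mcore_shift_double/andP[_ h2].
  case/negP: h2; apply: (high_downs (t := t)).
  rewrite (_ : t.+1%:Z = t%:Z + 1); last by lia.
  by have -> : - (k + (t%:Z + 1) * M%:Z) + M%:Z + t%:Z * M%:Z = - k by ring.
have Finj : injective F.
  move=> c c' e; apply: val_inj => /=.
  have [] := @euclid_uniq M c c' (f c) (f c'); rewrite ?lez_nat ?ltz_nat ?ltn_ord //.
  by case.
exists (sort <=%R (codom F)); split.
- by rewrite sort_lt_sorted; apply/injectiveP.
- by rewrite size_sort size_codom card_ord.
move=> k; rewrite mem_sort; split=> [ck|/codomP[c ->]]; last exact: fP.
have b0 : 0 <= modz k M by apply: modz_ge0; lia.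
have bM : modz k M < M%:Z by apply: ltz_pmod; lia.
have h : (`|modz k M| < M)%N by lia.
apply/codomP; exists (Ordinal h); set c := Ordinal h.
have kE : k = c%:Z + divz k M * M%:Z by have := divz_eq k M; rewrite /= gez0_abs //; lia.
rewrite kE /F; congr (_ + _ * _).
have [le|lt] := lerP (divz k M) (f c).
  have := uniqK k `|f c - divz k M|%N ck.
  rewrite gez0_abs ?subr_ge0 // [in X in _ + X]mulrBl {1}kE addrAC addrA.
  rewrite (_ : _ + _ = c%:Z + f c * M%:Z); last by lia.
  by move=> /(_ (fP c)); lia.
have := uniqK _ `|divz k M - f c|%N (fP c).
rewrite gez0_abs ?subr_ge0 ?ltW //.
rewrite (_ : _ + _ = k); last by rewrite {2}kE; lia.
by move=> /(_ ck); lia.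
Qed.

End Admissible.

(** In a strictly sorted list exactly j elements precede the entry of index j, and the cardinal j
    determines j. *)
Lemma is_nth_smallestP (s : seq int) (K : set int) i k : sorted <%R s ->
  (forall x, K x <-> x \in s) ->
  is_nth_smallest K i k <-> (i < size s)%N /\ k = nth 0 s i.
Proof.
move=> ss Ks; have us := lt_sorted_uniq ss.
have below j : (j < size s)%N -> [set x | K x /\ x < nth 0 s j] #= `I_j.
  move=> js; have -> : [set x | K x /\ x < nth 0 s j] = nth 0 s @` `I_j.
    apply/seteqP; split=> x /=.
      move=> [/Ks xs xj]; exists (index x s); last by rewrite nth_index.
      rewrite /= ltnNge; apply/negP => ji; move: xj; apply/negP; rewrite -leNgt.
      by rewrite -[leRHS](nth_index 0 xs) (lt_sorted_leq_nth 0 ss) ?inE ?index_mem.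
    move=> [l lj <-]; have ls := ltn_trans lj js.
    by split; [apply/Ks; exact: mem_nth|rewrite (lt_sorted_ltn_nth 0 ss)].
  apply: inj_card_eq => x y /set_mem /= xj /set_mem /= yj /eqP.
  by rewrite nth_uniq // ?(ltn_trans _ js) // => /eqP.
split=> [[/Ks ks ck]|[is_ ->]]; last by split; [apply/Ks; exact: mem_nth|exact: below].
have js : (index k s < size s)%N by rewrite index_mem.
have := below _ js; rewrite nth_index // => ck'.
have /card_eq_II e : `I_(index k s) #= `I_i.
  exact: card_eq_trans (card_esym ck') ck.
by rewrite -e nth_index.
Qed.

(** * The bijection *)

Section Bijection.
Variables (R : realType) (n m : nat).
Hypotheses (n0 : (0 < n)%N) (m0 : (0 < m)%N).
Local Notation alcA := (fold_alcove (foldA R n)).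
Local Notation alcC := (fold_alcove (foldC R n)).
Local Notation adm W := [set k | mcore m (shift_double W k)].

Let N0 : (0 < n + n)%N. Proof. by rewrite addn_gt0 n0. Qed.

Lemma window_shift_double (W : 'I_n -> int) k : window (shift_double W k).
Proof. exact: window_double. Qed.

Lemma balanced_shift_double (W : 'I_n -> int) k : balanced (shift_double W k).
Proof. exact: balanced_double. Qed.

Lemma alcoveC_expansion w k : window (@base_window n w) ->
  alcoveC (R := R) (n := n) (expansion n w k) = alcC (shift_double (base_window w) k).
Proof.
move=> wW; rewrite alcoveC_fold ?expansion_window //.
exact: window_shift_double.
Qed.

Lemma admissibleE w : window (@base_window n w) ->
  admissible R n m w = adm (@base_window n w).
Proof.
move=> wW; apply/seteqP; split=> k; rewrite /admissible /= alcoveC_expansion //;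
  by move/(m_minimal_mcore (F := foldC R n) N0 m0 (window_shift_double _ _)
           (balanced_shift_double _ _)).
Qed.

Lemma Bj1_graphP (C : set 'rV[R]_n) i (C' : set 'rV[R]_n) :
  Bj1_graph m C i C' <-> exists W k,
    [/\ window W, is_min_alcove (typeA R n) C (alcA W),
        is_nth_smallest (adm W) i k
      & is_min_alcove (typeC R n) C' (alcC (shift_double W k))].
Proof.
split=> [[w [k [pw Cw ik C'w]]]|[W [k [wW CW ik C'W]]]].
  have wW := window_base_window pw.
  exists (base_window w), k.
  by rewrite -alcoveA_fold // -admissibleE // -alcoveC_expansion.
have eW : @base_window n (perm_of_window W) = W.
  by apply/funext; exact: base_window_perm.
exists (perm_of_window W), k.
have wb : window (@base_window n (perm_of_window W)) by rewrite eW.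
rewrite alcoveA_fold // admissibleE // alcoveC_expansion // eW.
by split=> //; exact: perm_of_windowP.
Qed.

Lemma Bj1_graph_ex C (i : nat) : dominant_region (typeA R n) m C ->
  (i < m * n + 1)%N ->
  exists2 C', dominant_region (typeC R n) m C' & Bj1_graph m C i C'.
Proof.
move=> dC iM; have [W [wW _ cW minW]] := exists_min_alcove (foldA R n) n0 m0 dC.
have [s [ss sz sP]] := admissible_seq n0 wW cW.
have ck : mcore m (shift_double W (nth 0 s i)).
  by apply/sP; rewrite mem_nth // sz.
have [C' dC' minC'] := mcore_region (F := foldC R n) N0 m0
  (window_shift_double _ _) (balanced_shift_double _ _) ck.
exists C' => //; apply/Bj1_graphP; exists W, (nth 0 s i); split=> //.
by apply/(is_nth_smallestP _ _ ss sP); rewrite sz.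
Qed.

Lemma Bj1_graph_fun C i C1 C2 : dominant_region (typeA R n) m C ->
  dominant_region (typeC R n) m C1 -> dominant_region (typeC R n) m C2 ->
  Bj1_graph m C i C1 -> Bj1_graph m C i C2 -> C1 = C2.
Proof.
move=> dC dC1 dC2 /Bj1_graphP[W [k [wW CW ik C1W]]] /Bj1_graphP[V [l [wV CV il C2V]]].
have e : W = V := min_alcove_uniq (F := foldA R n) n0 m0 dC wW wV I I CW CV.
rewrite -{}e {V wV CV} in il C2V.
have cW := min_alcoveP (F := foldA R n) n0 m0 dC wW I CW.
have [s [ss sz sP]] := admissible_seq n0 wW cW.
have [_ ek] := (is_nth_smallestP i k ss sP).1 ik.
have [_ el] := (is_nth_smallestP i l ss sP).1 il.
rewrite el -ek in C2V.
exact: (min_alcove_region (F := foldC R n) N0 (window_shift_double _ _) (balanced_shift_double _ _)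
  dC1 dC2 C1W C2V).
Qed.

(** The minimal alcove of C' determines (W, k); then W determines the region, and k its rank in the
    admissible set. *)
Lemma Bj1_graph_inj C D i j C' : dominant_region (typeA R n) m C ->
  dominant_region (typeA R n) m D -> dominant_region (typeC R n) m C' ->
  Bj1_graph m C i C' -> Bj1_graph m D j C' -> C = D /\ i = j.
Proof.
move=> dC dD dC' /Bj1_graphP[W [k [wW CW ik C'W]]] /Bj1_graphP[V [l [wV DV jl C'V]]].
have e := min_alcove_uniq (F := foldC R n) N0 m0 dC' (window_shift_double _ _)
  (window_shift_double _ _) (balanced_shift_double _ _)
  (balanced_shift_double _ _) C'W C'V.
have [eW ek] := shift_double_inj n0 wW wV e.
rewrite -{}eW -{}ek {V l wV e C'V} in DV jl.
split; first exact: (min_alcove_region (F := foldA R n) n0 wW I dC dD CW DV).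
have cW := min_alcoveP (F := foldA R n) n0 m0 dC wW I CW.
have [s [ss sz sP]] := admissible_seq n0 wW cW.
have [iM ei] := (is_nth_smallestP i k ss sP).1 ik.
have [jM ej] := (is_nth_smallestP j k ss sP).1 jl.
by apply/eqP; rewrite -(nth_uniq 0 iM jM (lt_sorted_uniq ss)) -ei -ej.
Qed.

Lemma Bj1_graph_surj C' : dominant_region (typeC R n) m C' ->
  exists C i, [/\ dominant_region (typeA R n) m C, (i < m * n + 1)%N
                & Bj1_graph m C i C'].
Proof.
move=> dC'; have [u [wu bu cu minu]] := exists_min_alcove (foldC R n) N0 m0 dC'.
have [W [k [wW cW eu]]] := shift_double_surj n0 wu bu cu.
have [C dC minC] := mcore_region (F := foldA R n) n0 m0 wW I cW.
have [s [ss sz sP]] := admissible_seq n0 wW cW.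
have ks : k \in s by apply/sP; rewrite eu.
exists C, (index k s); split=> //; first by rewrite -sz index_mem.
apply/Bj1_graphP; exists W, k; rewrite eu; split=> //.
by apply/(is_nth_smallestP _ _ ss sP); rewrite index_mem nth_index.
Qed.

End Bijection.

Theorem theorem2p14 (R : realType) (n m : nat) (hn : (0 < n)%N) (hm : (0 < m)%N) :
  exists Bj1 : set_type (dominant_region (typeA R n) m) * 'I_(m * n + 1)
               -> set_type (dominant_region (typeC R n) m),
    (forall (C : set_type (dominant_region (typeA R n) m))
            (i : 'I_(m * n + 1))
            (C' : set_type (dominant_region (typeC R n) m)),
        Bj1 (C, i) = C' <-> Bj1_graph m (val C) i (val C'))
    /\ bijective Bj1.
Proof.
have /choice[f fP] : forall p : set_type (dominant_region (typeA R n) m) * 'I_(m * n + 1),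
    exists C' : set_type (dominant_region (typeC R n) m),
      Bj1_graph m (val p.1) p.2 (val C').
  move=> [C i]; have [C' dC' g] := Bj1_graph_ex hn hm (set_valP C) (ltn_ord i).
  by exists (SigSub (mem_set dC')).
exists f; split=> [C i C'|].
  split=> [<-|g]; first exact: (fP (C, i)).
  apply: val_inj.
  exact: (Bj1_graph_fun hn hm (set_valP C) (set_valP _) (set_valP _) (fP (C, i)) g).
have finj : injective f.
  move=> [C i] [D j] e; have := fP (C, i); rewrite e => g.
  have [eC eij] := Bj1_graph_inj hn hm (set_valP C) (set_valP D) (set_valP _) g (fP (D, j)).
  by congr pair; apply: val_inj.
have /choice[g gP] : forall C', exists p, f p = C'.
  move=> C'; have [C [i [dC iM gr]]] := Bj1_graph_surj hn hm (set_valP C').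
  pose p := (SigSub (mem_set dC), Ordinal iM); exists p; apply: val_inj.
  exact: (Bj1_graph_fun hn hm dC (set_valP (f p)) (set_valP C') (fP p) gr).
by exists g => // p; apply: finj; rewrite gP.
Qed.
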